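(* Let $\bar x\in\Phi$ be a local second-order weak sharp minimizer of problem (P) with corresponding constants $\kappa>0$ and $\delta>0$, and suppose that MSCQ holds at $\bar x$ for the system $g(x)\in K$. Then for any $\varepsilon\in[0,1/2)$ there exists $\delta'\in(0,\delta)$ such that for every $x\in S\cap B_{\delta'}(\bar x)$ and every $d\in C(x)\cap N^{P,\varepsilon}_S(x)$: (i) there exists $\lambda\in\Lambda(x;d)$ such that for every set $A\supset\Theta(x;d)$ one has $\hat\sigma_{T''_K(g(x);\nabla g(x)d),A}(\lambda)\le0$; in particular $\hat\sigma_{T''_K(g(x);\nabla g(x)d)}(\lambda)\le0$; (ii) if $T^2_K(g(x);\nabla g(x)d)\neq\emptyset$, then there exists $\lambda\in\Lambda(x;d)$ such that for every set $B\supset\Omega(x;d)$, $\nabla^2_{xx}L(x,\lambda)(d,d)-\hat\sigma_{T^2_K(g(x);\nabla g(x)d),B}(\lambda)\ge2\kappa(1-2\varepsilon)^2\|d\|^2$; in particular $\nabla^2_{xx}L(x,\lambda)(d,d)-\hat\sigma_{T^2_K(g(x);\nabla g(x)d)}(\lambda)\ge2\kappa(1-2\varepsilon)^2\|d\|^2$. Moreover, for every $x\in S\cap B_{\delta'}(\bar x)$ and every $d\in C(x)$ (not necessarily an $\varepsilon$-proximal normal), (i) holds and (ii) holds with the right-hand side $2\kappa(1-2\varepsilon)^2\|d\|^2$ replaced by $2\kappa[\mathrm{dist}(d,T_S(x))]^2$ in both inequalities.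
   Context: Standing setting: $f:\mathbb{R}^n\to\mathbb{R}$, $g:\mathbb{R}^n\to\mathbb{R}^m$ twice continuously differentiable, $K\subset\mathbb{R}^m$ closed; (P) is $\min f(x)$ s.t. $g(x)\in K$; $\Phi:=\{x:g(x)\in K\}$; $S$ is the (nonempty) set of optimal solutions of (P); $L(x,\lambda):=f(x)+\langle g(x),\lambda\rangle$. $\bar x\in\Phi$ is a local second-order weak sharp minimizer with constants $\kappa,\delta>0$ if $f(x)\ge f(\bar x)+\kappa[\mathrm{dist}(x,S)]^2$ for all $x\in\Phi\cap B_\delta(\bar x)$. MSCQ holds at $\bar x$ if there are $\delta_0,\kappa_0>0$ with $\mathrm{dist}(x,\Phi)\le\kappa_0\,\mathrm{dist}(g(x),K)$ for all $x\in B_{\delta_0}(\bar x)$. For a closed set $A$ and $\bar x\in A$: $T_A(\bar x):=\{d:\exists t_k\downarrow0,d_k\to d,\bar x+t_kd_k\in A\}$; for $d\in T_A(\bar x)$, $T^2_A(\bar x;d):=\{w:\exists t_k\downarrow0,w_k\to w,\bar x+t_kd+\tfrac12t_k^2w_k\in A\}$, $T''_A(\bar x;d):=\{w:\exists(t_k,r_k)\downarrow(0,0),t_k/r_k\to0,w_k\to w,\bar x+t_kd+\tfrac12t_kr_kw_k\in A\}$. $C(x):=\{d:\nabla g(x)d\in T_K(g(x)),\nabla f(x)d\le0\}$. Proximal normal cone $N^P_A(\bar x):=\{v:\exists\tau>0,\ \bar x\text{ is a nearest point of }A\text{ to }\bar x+\tau v\}$; $N^{P,\varepsilon}_A(\bar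 x):=\{v:\mathrm{dist}(v,N^P_A(\bar x))\le\varepsilon\|v\|\}$. Fréchet normal cone $\hat N_A(\bar x):=\{v:\limsup_{x\to\bar x,x\in A}\langle v,x-\bar x\rangle/\|x-\bar x\|\le0\}$ (empty if $\bar x\notin A$); limiting normal cone $N_A(\bar x):=\{v:\exists x_k\to\bar x, x_k\in A, v_k\to v, v_k\in\hat N_A(x_k)\}$; directional limiting normal cone $N_A(\bar x;d):=\{v:\exists t_k\downarrow0,d_k\to d,v_k\to v,\ v_k\in\hat N_A(\bar x+t_kd_k)\}$. Directional M-multiplier set: $\Lambda(x;d):=\{\lambda\in\mathbb{R}^m:\nabla_xL(x,\lambda)=0,\ \lambda\in N_K(g(x);\nabla g(x)d)\}$. $\Theta(x;d):=\nabla g(x)(T''_\Phi(x;d))$ and $\Omega(x;d):=\nabla g(x)(T^2_\Phi(x;d))+\nabla^2g(x)(d,d)$, where $\nabla^2g(x)(d,d):=(d^T\nabla^2g_i(x)d)_{i=1}^m$ and $\nabla g(x)(A):=\{\nabla g(x)u:u\in A\}$. Lower generalized support function: for a nonempty closed $D\subset\mathbb{R}^m$ and $A\subset\mathbb{R}^m$, $\hat\sigma_{D,A}(\lambda):=\liminf_{\lambda'\to\lambda}\inf\{\langle\lambda',u\rangle: u\in A,\ \lambda'\in N_D(u)\}$ (with $\inf\emptyset=+\infty$); if $D=\emptyset$, $\hat\sigma_{D,A}\equiv-\infty$; $\hat\sigma_D:=\hat\sigma_{D,\mathbb{R}^m}$. *)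

(* Defs.v *)
(* Vectors of R^k are column vectors 'cV[R]_k,
   R : realType.  Norms, inner products, balls and distances are Euclidean. *)
From mathcomp Require Import all_boot all_order all_algebra.
From mathcomp Require Import all_classical all_reals all_analysis.
Set Implicit Arguments. Unset Strict Implicit. Unset Printing Implicit Defensive.
Import Order.TTheory GRing.Theory Num.Theory numFieldNormedType.Exports.
Local Open Scope classical_set_scope.
Local Open Scope ring_scope.

Section Defs.
Variable R : realType.

Definition dotv {k} (u v : 'cV[R]_k) : R := \sum_(i < k) u i 0 * v i 0.
Definition enorm {k} (u : 'cV[R]_k) : R := Num.sqrt (dotv u u).
Definition setdist {k} (x : 'cV[R]_k) (A : set 'cV[R]_k) : R :=
  inf [set enorm (x - a) | a in A].
Definition eball {k} (x : 'cV[R]_k) (r : R) : set 'cV[R]_k :=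
  [set y | enorm (y - x) < r].

Definition evec {n} (i : 'I_n) : 'cV[R]_n := delta_mx i 0.
Definition partial {n} (i : 'I_n) (h : 'cV[R]_n -> R) (x : 'cV[R]_n) : R :=
  derive1 (fun t : R => h (x + t *: evec i)) 0.
Definition C1fun {n} (h : 'cV[R]_n -> R) : Prop :=
  (forall x i, derivable (fun t : R => h (x + t *: evec i)) 0 1) /\
  (forall i, continuous (partial i h)).
Definition C2fun {n} (h : 'cV[R]_n -> R) : Prop :=
  C1fun h /\ forall i, C1fun (partial i h).
Definition C2map {n m} (g : 'cV[R]_n -> 'cV[R]_m) : Prop :=
  forall j, C2fun (fun x => g x j 0).

Definition grad {n} (h : 'cV[R]_n -> R) (x : 'cV[R]_n) : 'cV[R]_n :=
  \col_i partial i h x.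
Definition jac {n m} (g : 'cV[R]_n -> 'cV[R]_m) (x : 'cV[R]_n) : 'M[R]_(m, n) :=
  \matrix_(j, i) partial i (fun y => g y j 0) x.
Definition hess {n} (h : 'cV[R]_n -> R) (x : 'cV[R]_n) : 'M[R]_n :=
  \matrix_(i, j) partial j (partial i h) x.
Definition qform {n} (H : 'M[R]_n) (d : 'cV[R]_n) : R := (d^T *m H *m d) 0 0.
Definition hess2 {n m} (g : 'cV[R]_n -> 'cV[R]_m) (x d : 'cV[R]_n) : 'cV[R]_m :=
  \col_j qform (hess (fun y => g y j 0) x) d.

Definition lagr {n m} (f : 'cV[R]_n -> R) (g : 'cV[R]_n -> 'cV[R]_m)
  (x : 'cV[R]_n) (lam : 'cV[R]_m) : R := f x + dotv (g x) lam.

Definition pos_to0 (t : nat -> R) : Prop :=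
  (forall k, 0 < t k) /\ t k @[k --> \oo] --> 0.

Definition tangent_cone {k} (A : set 'cV[R]_k) (x : 'cV[R]_k) : set 'cV[R]_k :=
  [set d | exists (t : nat -> R) (dk : nat -> 'cV[R]_k),
     pos_to0 t /\ dk j @[j --> \oo] --> d /\ forall j, A (x + t j *: dk j)].

Definition tangent2 {k} (A : set 'cV[R]_k) (x d : 'cV[R]_k) : set 'cV[R]_k :=
  [set w | exists (t : nat -> R) (wk : nat -> 'cV[R]_k),
     pos_to0 t /\ wk j @[j --> \oo] --> w /\
     forall j, A (x + t j *: d + (2^-1 * t j ^+ 2) *: wk j)].

Definition tangentpp {k} (A : set 'cV[R]_k) (x d : 'cV[R]_k) : set 'cV[R]_k :=
  [set w | exists (t r : nat -> R) (wk : nat -> 'cV[R]_k),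
     pos_to0 t /\ pos_to0 r /\ (t j / r j) @[j --> \oo] --> 0 /\
     wk j @[j --> \oo] --> w /\
     forall j, A (x + t j *: d + (2^-1 * t j * r j) *: wk j)].

Definition nearest_point {k} (A : set 'cV[R]_k) (x y : 'cV[R]_k) : Prop :=
  A x /\ forall a, A a -> enorm (y - x) <= enorm (y - a).

Definition prox_normal {k} (A : set 'cV[R]_k) (x : 'cV[R]_k) : set 'cV[R]_k :=
  [set v | exists tau : R, 0 < tau /\ nearest_point A x (x + tau *: v)].

Definition prox_normal_eps {k} (A : set 'cV[R]_k) (x : 'cV[R]_k) (eps : R)
  : set 'cV[R]_k :=
  [set v | A x /\ setdist v (prox_normal A x) <= eps * enorm v].

(* Frechet normal cone: empty if x \notin A; limsup <= 0 written out *)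
Definition frechet_normal {k} (A : set 'cV[R]_k) (x : 'cV[R]_k) : set 'cV[R]_k :=
  [set v | A x /\ forall eta : R, 0 < eta -> exists rho : R, 0 < rho /\
     forall y, A y -> 0 < enorm (y - x) < rho ->
       dotv v (y - x) <= eta * enorm (y - x)].

Definition limiting_normal {k} (A : set 'cV[R]_k) (x : 'cV[R]_k) : set 'cV[R]_k :=
  [set v | exists (xk vk : nat -> 'cV[R]_k),
     (forall j, A (xk j)) /\ xk j @[j --> \oo] --> x /\
     vk j @[j --> \oo] --> v /\ forall j, frechet_normal A (xk j) (vk j)].

Definition dir_normal {k} (A : set 'cV[R]_k) (x d : 'cV[R]_k) : set 'cV[R]_k :=
  [set v | exists (t : nat -> R) (dk vk : nat -> 'cV[R]_k),
     pos_to0 t /\ dk j @[j --> \oo] --> d /\ vk j @[j --> \oo] --> v /\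
     forall j, frechet_normal A (x + t j *: dk j) (vk j)].

Section Problem.
Variables (n m : nat) (f : 'cV[R]_n -> R) (g : 'cV[R]_n -> 'cV[R]_m)
  (K : set 'cV[R]_m).

Definition feasible : set 'cV[R]_n := [set x | K (g x)].
Definition solset : set 'cV[R]_n :=
  [set x | feasible x /\ forall y, feasible y -> f x <= f y].

Definition local_2nd_weak_sharp_min (xbar : 'cV[R]_n) (kappa delta : R) : Prop :=
  feasible xbar /\ 0 < kappa /\ 0 < delta /\
  forall x, feasible x -> eball xbar delta x ->
    f xbar + kappa * (setdist x solset) ^+ 2 <= f x.

Definition MSCQ (xbar : 'cV[R]_n) : Prop :=
  exists delta0 kappa0 : R, 0 < delta0 /\ 0 < kappa0 /\
    forall x, eball xbar delta0 x -> setdist x feasible <= kappa0 * setdist (g x) K.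

Definition crit_cone (x : 'cV[R]_n) : set 'cV[R]_n :=
  [set d | tangent_cone K (g x) (jac g x *m d) /\ dotv (grad f x) d <= 0].

Definition dir_multipliers (x d : 'cV[R]_n) : set 'cV[R]_m :=
  [set lam | grad (fun y => lagr f g y lam) x = 0 /\
             dir_normal K (g x) (jac g x *m d) lam].

Definition Theta (x d : 'cV[R]_n) : set 'cV[R]_m :=
  [set jac g x *m u | u in tangentpp feasible x d].

Definition Omega (x d : 'cV[R]_n) : set 'cV[R]_m :=
  [set jac g x *m u + hess2 g x d | u in tangent2 feasible x d].

End Problem.

Local Open Scope ereal_scope.
(* inf { <lam', u> : u \in A, lam' \in N_D(u) }, inf of the empty set = +oo *)
Definition lsupp_inner {k} (D A : set 'cV[R]_k) (lam' : 'cV[R]_k) : \bar R :=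
  ereal_inf [set (dotv lam' u)%:E | u in [set u | A u /\ limiting_normal D u lam']].

(* liminf_{lam' -> lam} h(lam') = sup_{r > 0} inf_{lam' \in B_r(lam)} h(lam') *)
Definition lsupp {k} (D A : set 'cV[R]_k) (lam : 'cV[R]_k) : \bar R :=
  if pselect (D = set0) then -oo
  else ereal_sup [set ereal_inf [set lsupp_inner D A l' | l' in eball lam r]
                  | r in [set r : R | (0 < r)%R]].

Definition lsupp_full {k} (D : set 'cV[R]_k) (lam : 'cV[R]_k) : \bar R :=
  lsupp D setT lam.

End Defs.

(* Main.v *)
Require Import Defs.
From mathcomp Require Import all_boot all_order all_algebra.
From mathcomp Require Import all_classical all_reals all_analysis.
From mathcomp Require Import ring lra.
Import Order.TTheory GRing.Theory Num.Theory numFieldNormedType.Exports.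
Local Open Scope classical_set_scope.
Local Open Scope ring_scope.

(** The sets [T''_A(x; d)] and [T^2_A(x; d)] are the cases [theta = 0] and
    [theta = 1] of one outer limit [gtan theta]: points [x + t d + (t s / 2) w']
    of [A] with [t, s -> 0] and [t / s -> theta].  Under MSCQ the set
    [gtan theta Phi] is the preimage of [D := gtan theta K] under the affine map
    [w |-> G w + theta h], where [G] is the Jacobian and [h] the second
    derivative of [g] along [d], with a global error bound; weak sharpness
    bounds the linear form [<grad f, w>] from below on it.  This linear program
    need not attain its infimum, so [a^2 |w|^2] is added to the objective and the
    constraint is penalised quadratically.  The minimisers yield proximal normals
    to [D] whose size is controlled by the error bound; letting first the
    penalty grow and then [a] tend to [0] gives the multiplier.  Since
    [<G^T lam', w> = - <grad f, w> - 2 a^2 |w|^2], the regularisation only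
    improves the estimate of [<lam', u>], even when [w] is unbounded.
    Proximal normals to the outer limit [D] are limits of normals to [K] at
    points approached in direction [G d], hence the multiplier is directional.
    If [T''_K] is empty then [T^2_K] is not, and its multiplier serves in (i). *)

Ltac vec_ring := apply/colP => ?; rewrite !mxE; ring.

(** * Euclidean norm and topology of column vectors *)

Lemma dotvC {R : realType} {k} (u v : 'cV[R]_k) : dotv u v = dotv v u.
Proof. by apply: eq_bigr => i _; rewrite mulrC. Qed.

Lemma dotvDl {R : realType} {k} (u v w : 'cV[R]_k) :
  dotv (u + v) w = dotv u w + dotv v w.
Proof. by rewrite -big_split; apply: eq_bigr => i _; rewrite mxE mulrDl. Qed.

Lemma dotvDr {R : realType} {k} (u v w : 'cV[R]_k) :
  dotv u (v + w) = dotv u v + dotv u w.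
Proof. by rewrite dotvC dotvDl !(dotvC u). Qed.

Lemma dotvZl {R : realType} {k} a (u v : 'cV[R]_k) :
  dotv (a *: u) v = a * dotv u v.
Proof. by rewrite mulr_sumr; apply: eq_bigr => i _; rewrite mxE mulrA. Qed.

Lemma dotvZr {R : realType} {k} a (u v : 'cV[R]_k) :
  dotv u (a *: v) = a * dotv u v.
Proof. by rewrite dotvC dotvZl dotvC. Qed.

Lemma dotvNl {R : realType} {k} (u v : 'cV[R]_k) : dotv (- u) v = - dotv u v.
Proof. by rewrite -scaleN1r dotvZl mulN1r. Qed.

Lemma dotvNr {R : realType} {k} (u v : 'cV[R]_k) : dotv u (- v) = - dotv u v.
Proof. by rewrite dotvC dotvNl dotvC. Qed.

Lemma dotv0l {R : realType} {k} (u : 'cV[R]_k) : dotv 0 u = 0.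
Proof. by rewrite -(scale0r u) dotvZl mul0r. Qed.

Lemma dotv0r {R : realType} {k} (u : 'cV[R]_k) : dotv u 0 = 0.
Proof. by rewrite dotvC dotv0l. Qed.

Definition dotvE := (@dotvDl, @dotvDr, @dotvNl, @dotvNr, @dotvZl, @dotvZr).

Lemma dotvv_ge0 {R : realType} {k} (u : 'cV[R]_k) : 0 <= dotv u u.
Proof. by apply: sumr_ge0 => i _; rewrite -expr2 sqr_ge0. Qed.

Lemma dotv_mulmx {R : realType} {m n} (G : 'M[R]_(m, n)) (w : 'cV[R]_n) v :
  dotv (G *m w) v = dotv w (G^T *m v).
Proof.
have dE l (a b : 'cV[R]_l) : dotv a b = (a^T *m b) 0 0.
  by rewrite mxE; apply: eq_bigr => i _; rewrite mxE.
by rewrite !dE trmx_mul -mulmxA.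
Qed.

Lemma sqr_enorm {R : realType} {k} (u : 'cV[R]_k) : enorm u ^+ 2 = dotv u u.
Proof. by rewrite sqr_sqrtr // dotvv_ge0. Qed.

Lemma enorm_ge0 {R : realType} {k} (u : 'cV[R]_k) : 0 <= enorm u.
Proof. exact: sqrtr_ge0. Qed.
#[local] Hint Extern 0 (is_true (_ <= enorm _)) => apply: enorm_ge0 : core.

Lemma enorm0 {R : realType} {k} : enorm (0 : 'cV[R]_k) = 0.
Proof. by rewrite /enorm dotv0l sqrtr0. Qed.

Lemma enormZ {R : realType} {k} a (u : 'cV[R]_k) :
  enorm (a *: u) = `|a| * enorm u.
Proof.
by rewrite /enorm dotvZl dotvZr mulrA -expr2 sqrtrM ?sqr_ge0 // sqrtr_sqr.
Qed.

Lemma enormN {R : realType} {k} (u : 'cV[R]_k) : enorm (- u) = enorm u.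
Proof. by rewrite -scaleN1r enormZ normrN1 mul1r. Qed.

Lemma enormBC {R : realType} {k} (u v : 'cV[R]_k) : enorm (u - v) = enorm (v - u).
Proof. by rewrite -enormN opprB. Qed.

Lemma enorm_eq0 {R : realType} {k} (u : 'cV[R]_k) : enorm u = 0 -> u = 0.
Proof.
move=> u0; have : dotv u u = 0 by rewrite -sqr_enorm u0 expr0n.
move/eqP; rewrite psumr_eq0; last by move=> i _; rewrite -expr2 sqr_ge0.
move/allP => h; apply/colP => i; rewrite mxE.
by have := h i (mem_index_enum _); rewrite mulf_eq0 orbb => /eqP.
Qed.

(** The squared norm of [|v| u - |u| v] equals [2 |u| |v| (|u| |v| - <u, v>)], and it is
    nonnegative. *)
Lemma dotv_le {R : realType} {k} (u v : 'cV[R]_k) :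
  dotv u v <= enorm u * enorm v.
Proof.
have [v0|v0] := eqVneq (enorm v) 0.
  by rewrite (enorm_eq0 v v0) dotv0r enorm0 mulr0.
have vp : 0 < enorm v by rewrite lt_neqAle eq_sym v0 enorm_ge0.
have := dotvv_ge0 (enorm v *: u - enorm u *: v).
rewrite !dotvE -!sqr_enorm (dotvC v u) => h.
have [u0|u0] := eqVneq (enorm u) 0.
  by rewrite (enorm_eq0 u u0) dotv0l enorm0 mul0r.
have up : 0 < enorm u by rewrite lt_neqAle eq_sym u0 enorm_ge0.
have uv : 0 < enorm u * enorm v by rewrite mulr_gt0.
rewrite -(ler_pM2l uv); nra.
Qed.

Lemma normr_dotv_le {R : realType} {k} (u v : 'cV[R]_k) :
  `|dotv u v| <= enorm u * enorm v.
Proof.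
by rewrite ler_norml dotv_le andbT lerNl -dotvNl -(enormN u) dotv_le.
Qed.

Lemma ler_of_sqr {R : realType} (a b : R) : 0 <= b -> a ^+ 2 <= b ^+ 2 -> a <= b.
Proof. by move=> b0 ab; rewrite leNgt; apply/negP => ba; nra. Qed.

Lemma ler_enormD {R : realType} {k} (u v : 'cV[R]_k) :
  enorm (u + v) <= enorm u + enorm v.
Proof.
apply: ler_of_sqr; first by rewrite addr_ge0.
rewrite sqrrD sqr_enorm !dotvE -!sqr_enorm (dotvC v u).
by have := dotv_le u v; lra.
Qed.

Lemma ler_enormB {R : realType} {k} (u v : 'cV[R]_k) :
  enorm (u - v) <= enorm u + enorm v.
Proof. by rewrite -(enormN v) ler_enormD. Qed.

Lemma ler_enorm_dist {R : realType} {k} (w u v : 'cV[R]_k) :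
  enorm (u - v) <= enorm (u - w) + enorm (w - v).
Proof. by apply: le_trans (ler_enormD _ _); rewrite addrA subrK. Qed.

Lemma ler_enormBD {R : realType} {k} (u v : 'cV[R]_k) :
  enorm u <= enorm v + enorm (u - v).
Proof. by apply: le_trans (ler_enormD _ _); rewrite addrC subrK. Qed.

Lemma normr_coord_le_enorm {R : realType} {k} (u : 'cV[R]_k) i :
  `|u i 0| <= enorm u.
Proof.
apply: ler_of_sqr => //; rewrite sqr_enorm real_normK ?num_real //.
rewrite /dotv (bigD1 i) //= -expr2 lerDl.
by apply: sumr_ge0 => j _; rewrite -expr2 sqr_ge0.
Qed.

Lemma enorm_le_sum {R : realType} {k} (u : 'cV[R]_k) :
  enorm u <= \sum_i `|u i 0|.
Proof.
have s0 (P : pred 'I_k) : 0 <= \sum_(i | P i) `|u i 0| by exact: sumr_ge0.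
apply: ler_of_sqr; first exact: s0.
rewrite sqr_enorm expr2 mulr_suml; apply: ler_sum => i _.
rewrite (le_trans (ler_norm _)) // normrM ler_wpM2l //.
by rewrite (bigD1 i) //= lerDl s0.
Qed.

(** Dividing by [k + 1] rather than [k] keeps the sum of [k] terms strictly below [e] and covers
    [k = 0]. *)
Lemma enorm_lt {R : realType} {k} (u : 'cV[R]_k) (e : R) :
  0 < e -> (forall i, `|u i 0| < e / k.+1%:R) -> enorm u < e.
Proof.
move=> e0 h; apply: le_lt_trans (enorm_le_sum u) _.
apply: (@le_lt_trans _ _ (\sum_(i < k) e / k.+1%:R)).
  by apply: ler_sum => i _; exact: ltW.
rewrite sumr_const card_ord -[_ *+ k]mulr_natr mulrAC ltr_pdivrMr ?ltr0n //.
by rewrite ltr_pM2l // ltr_nat.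
Qed.

Lemma mulmx_bounded {R : realType} {m n} (G : 'M[R]_(m, n)) :
  exists M : R, 0 < M /\ forall w, enorm (G *m w) <= M * enorm w.
Proof.
exists (1 + \sum_i \sum_j `|G i j|); split.
  by rewrite ltr_pwDl // sumr_ge0 // => i _; exact: sumr_ge0.
move=> w; apply: le_trans (enorm_le_sum _) _.
rewrite mulrDl mul1r mulr_suml ler_wpDl // ler_sum // => i _.
rewrite mxE mulr_suml (le_trans (ler_norm_sum _ _ _)) // ler_sum // => j _.
by rewrite normrM ler_wpM2l // normr_coord_le_enorm.
Qed.

Lemma enorm_eq_small {R : realType} {k} (u : 'cV[R]_k) (C : R) :
  0 < C -> (forall e : R, 0 < e -> enorm u <= C * e) -> u = 0.
Proof.
move=> C0 h; apply: enorm_eq0; apply/eqP; rewrite eq_le enorm_ge0 andbT.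
apply/ler_addgt0Pr => e e0; rewrite add0r.
by have := h (e / C) (divr_gt0 e0 C0); rewrite mulrC divfK // gt_eqF.
Qed.

(** * Topology and compactness through Euclidean balls *)

Lemma nbhs_eball {R : realType} {k} (x : 'cV[R]_k) (U : set 'cV[R]_k) :
  nbhs x U <-> exists2 e : R, 0 < e & eball x e `<=` U.
Proof.
split=> [/nbhs_ballP[e /= e0 eU]|[e e0 eU]].
  exists e => // y; rewrite /eball/= => ye; apply: eU; split=> // i j.
  rewrite ord1 -ball_normE /= distrC; apply: le_lt_trans ye.
  by have := normr_coord_le_enorm (y - x) i; rewrite !mxE.
(* The balls of the topology are coordinatewise; the factor [k + 1] pays for the passage to the
   Euclidean norm. *)
apply/nbhs_ballP; exists (e / k.+1%:R); first by rewrite /= divr_gt0 ?ltr0n.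
move=> y [_ xy]; apply: eU; apply: enorm_lt => // i.
by have := xy i 0; rewrite -ball_normE /= distrC !mxE.
Qed.

Lemma cvg_enormP {R : realType} {k} (w : nat -> 'cV[R]_k) (l : 'cV[R]_k) :
  w j @[j --> \oo] --> l <->
  forall e : R, 0 < e -> exists N, forall j, (N <= j)%N -> enorm (w j - l) < e.
Proof.
split=> [wl e e0|h U].
  have /wl [N _ hN] : nbhs l (eball l e) by apply/nbhs_eball; exists e.
  by exists N => j; exact: hN.
move=> /nbhs_eball[e e0 eU]; have [N hN] := h e e0.
by exists N => // j Nj; apply: eU; exact: hN.
Qed.

Lemma cvg_rP {R : realType} (w : nat -> R) (l : R) :
  w j @[j --> \oo] --> l <->
  forall e : R, 0 < e -> exists N, forall j, (N <= j)%N -> `|w j - l| < e.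
Proof.
rewrite cvgrPdistC_lt; split=> h e e0; have [N] := h e e0.
  by move=> _ hN; exists N.
by move=> hN; exists N.
Qed.

Lemma closed_enormP {R : realType} {k} (A : set 'cV[R]_k) :
  closed A <->
  forall x, (forall e : R, 0 < e -> exists2 a, A a & enorm (a - x) < e) -> A x.
Proof.
split=> [cA x h|h x cx].
  apply: cA => U /nbhs_eball[e e0 eU]; have [a Aa ax] := h e e0.
  by exists a; split => //; exact: eU.
apply: h => e e0; have [|a [Aa ae]] := cx (eball x e); last by exists a.
by apply/nbhs_eball; exists e.
Qed.

Lemma enormB_continuous {R : realType} {k} (y : 'cV[R]_k) :
  continuous (fun w : 'cV[R]_k => enorm (y - w)).
Proof.
move=> w U /nbhs_ballP[e /= e0 eU]; apply/nbhs_eball; exists e => // z zw.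
apply: eU; rewrite -ball_normE /= ltr_norml; move: zw; rewrite /eball /=.
have := ler_enorm_dist z y w; have := ler_enorm_dist w y z.
by rewrite (enormBC w z); lra.
Qed.

(** A cube of row vectors is compact as a product of segments; its transpose contains the ball,
    which is closed. *)
Lemma compact_cball {R : realType} {k} (C : R) :
  compact [set w : 'cV[R]_k | enorm w <= C].
Proof.
have cI : compact [set v : 'rV[R]_k | forall i, `[- C, C]%classic (v ord0 i)].
  by apply: (@rV_compact _ _ (fun=> `[- C, C]%classic)) => _; exact: segment_compact.
have tc : continuous (@trmx R 1 k).
  move=> v U /nbhs_ballP[e /= e0 eU]; apply/nbhs_ballP; exists e => // y [_ vy].
  by apply: eU; split=> // i j; rewrite !mxE.
have := continuous_compact (continuous_subspaceT tc) cI.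
move=> /(subclosed_compact _); apply.
  apply/closed_enormP => x h; apply/ler_addgt0Pr => e e0.
  have [a /= aC ax] := h e e0; rewrite enormBC in ax.
  by have := ler_enormBD x a; lra.
move=> w /= wC; exists w^T; last by rewrite trmxK.
move=> i /=; rewrite mxE in_itv /= -ler_norml.
exact: le_trans (normr_coord_le_enorm _ _) wC.
Qed.

(** * Vanishing tolerances and cluster points *)

Lemma invS_gt0 {R : realType} (j : nat) : 0 < (j.+1%:R : R)^-1.
Proof. by rewrite invr_gt0 ltr0n. Qed.
#[local] Hint Extern 0 (is_true (_ < _.+1%:R^-1)) => apply: invS_gt0 : core.

Lemma invS_lt {R : realType} (e : R) : 0 < e ->
  exists N, forall j, (N <= j)%N -> (j.+1%:R : R)^-1 < e.
Proof.
move=> e0; have /cvg_rP/(_ e e0)[N hN] := @cvg_harmonic R.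
exists N => j /hN; rewrite subr0; exact: le_lt_trans (ler_norm _).
Qed.

(** Countable choice along the tolerances [1 / (j + 1)]: it turns statements for every [e] into the
    sequences that tangent and normal cones ask for. *)
Lemma eps_choice {R : realType} {T : Type} (P : R -> T -> Prop) :
  (forall e : R, 0 < e -> exists z, P e z) ->
  exists z : nat -> T, forall j, P (j.+1%:R)^-1 (z j).
Proof.
move=> h.
have h' (j : nat) : exists z, P (j.+1%:R)^-1 z by exact: h.
by have [z hz] := choice h'; exists z.
Qed.

(** Bolzano-Weierstrass without subsequences. Monotonicity in the tolerance lets any late term of
    the sequence serve for a given [e]. Every passage to a limit below goes through this form. *)
Lemma bounded_cluster {R : realType} {k} (P : R -> 'cV[R]_k -> Prop) (C : R) :
  (forall (e e' : R) w, e <= e' -> P e w -> P e' w) ->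
  (forall e : R, 0 < e -> exists w, enorm w <= C /\ P e w) ->
  exists w0 : 'cV[R]_k, enorm w0 <= C /\
    forall e : R, 0 < e -> exists w, enorm (w - w0) < e /\ P e w.
Proof.
move=> mono /eps_choice[w hw].
have [|w0 [w0C cl]] := @compact_cball R k C (w @ \oo) _.
  by exists 0%N => // j _ /=; have [] := hw j.
exists w0; split=> // e e0; have [N hN] := invS_lt e e0.
have [| |y [[j Nj <-] ye]] := cl (w @` [set j | (N <= j)%N]) (eball w0 e).
- by exists N => // j Nj; exists j.
- by apply/nbhs_eball; exists e.
exists (w j); split=> //; apply: mono (proj2 (hw j)); exact/ltW/hN.
Qed.

(** * Nearest points and distances to sets *)

Lemma nearest_point_exists {R : realType} {k} (A : set 'cV[R]_k) (y : 'cV[R]_k) :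
  closed A -> A !=set0 -> exists p, nearest_point A p y.
Proof.
(* Points of norm above [C] are farther from [y] than [a0], so the minimum over the compact part of
   [A] is global. *)
move=> cA [a0 Aa0]; pose C := enorm y + enorm (y - a0).
have cpt : compact ([set w | enorm w <= C] `&` A).
  by apply: compact_closedI => //; exact: compact_cball.
have ne : ([set w | enorm w <= C] `&` A) !=set0.
  by exists a0; split=> //=; rewrite /C (enormBC y) ler_enormBD.
have [p] := compact_EVT_min ne cpt (continuous_subspaceT (enormB_continuous y)).
rewrite inE => -[_ Ap] hp; exists p; split=> // a Aa.
have [aC|aC] := leP (enorm a) C.
  by apply: hp; rewrite inE; split.
have : a0 \in [set w | enorm w <= C] `&` A.
  by rewrite inE; split=> //=; rewrite /C (enormBC y) ler_enormBD.
move=> /hp /le_trans; apply; have := ler_enormBD a y.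
by rewrite (enormBC a); move: aC; rewrite /C; lra.
Qed.

Lemma setdist_has_inf {R : realType} {k} (x : 'cV[R]_k) (A : set 'cV[R]_k) :
  A !=set0 -> has_inf [set enorm (x - a) | a in A].
Proof.
by move=> [a Aa]; split; [exists (enorm (x - a)), a|exists 0 => _ [b _ <-]].
Qed.

Lemma setdist_le {R : realType} {k} (x : 'cV[R]_k) (A : set 'cV[R]_k) a :
  A a -> setdist x A <= enorm (x - a).
Proof.
move=> Aa; apply: ge_inf; last by exists a.
by exists 0 => _ [b _ <-].
Qed.

Lemma le_setdist {R : realType} {k} (x : 'cV[R]_k) (A : set 'cV[R]_k) r :
  A !=set0 -> (forall a, A a -> r <= enorm (x - a)) -> r <= setdist x A.
Proof.
move=> [a0 Aa0] h; apply: lb_le_inf; first by exists (enorm (x - a0)), a0.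
by move=> _ [a Aa <-]; exact: h.
Qed.

Lemma setdist_lt {R : realType} {k} (x : 'cV[R]_k) (A : set 'cV[R]_k) r :
  A !=set0 -> setdist x A < r -> exists2 a, A a & enorm (x - a) < r.
Proof.
move=> An xr; have [_ [a Aa <-] ar] := inf_lt (proj1 (setdist_has_inf x A An)) xr.
by exists a.
Qed.

Lemma setdist_ge0 {R : realType} {k} (x : 'cV[R]_k) (A : set 'cV[R]_k) :
  A !=set0 -> 0 <= setdist x A.
Proof. by move=> An; exact: le_setdist. Qed.

(** * Second-order Taylor expansion from continuous partial derivatives *)

Lemma is_derive_of_expansion {R : realType} (phi : R -> R) (t L : R) :
  (forall e, 0 < e -> exists2 r : R, 0 < r & forall s, `|s| < r ->
     `|phi (t + s) - phi t - s * L| <= e * `|s|) ->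
  is_derive t 1 phi L.
Proof.
move=> h.
have cvL : (fun s : R => s^-1 *: ((phi \o shift t) (s *: 1) - phi t)) @ 0^' --> L.
  apply/cvgrPdistC_le => e e0; have [r r0 hr] := h e e0.
  exists r => //= s; rewrite /ball_ /= sub0r normrN => sr s0.
  have := hr s sr; rewrite [s *: 1]mulr1 [t + s]addrC => hs.
  rewrite -(@ler_pM2r _ `|s|) ?normr_gt0 // -normrM.
  suff -> : (s^-1 *: (phi (s + t) - phi t) - L) * s = phi (s + t) - phi t - s * L by [].
  by rewrite /GRing.scale /=; field.
apply: DeriveDef; first by apply/cvg_ex; exists L.
exact: cvg_lim cvL.
Qed.

(** Derivability is assumed at parameter [0] for every base point; moving the base point to
    [x + t e_i] gives it at every [t]. *)
Lemma is_derive_partial {R : realType} {n} (h : 'cV[R]_n -> R) (x : 'cV[R]_n) i (t : R) :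
  (forall y : 'cV[R]_n, derivable (fun s : R => h (y + s *: evec R i)) 0 1) ->
  is_derive t 1 (fun s : R => h (x + s *: evec R i)) (partial i h (x + t *: evec R i)).
Proof.
move=> dh; pose y := x + t *: evec R i.
have E : (fun s : R => s^-1 *: (((fun u : R => h (x + u *: evec R i)) \o shift t) (s *: 1)
            - h (x + t *: evec R i)))
   = (fun s : R => s^-1 *: (((fun u : R => h (y + u *: evec R i)) \o shift 0) (s *: 1)
            - h (y + 0 *: evec R i))).
  apply/funext => s /=; rewrite /y scale0r !addr0 scalerDl.
  by rewrite [in RHS]addrAC addrA.
apply: DeriveDef; first by have := dh y; rewrite /derivable -E.
by rewrite /partial derive1E /derive -E.
Qed.

Lemma MVT_from0 {R : realType} (f df : R -> R) (a : R) :
  (forall t : R, is_derive t 1 f (df t)) ->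
  exists2 c, `|c| <= `|a| & f a - f 0 = df c * a.
Proof.
move=> hf.
have cf (u v : R) : {within `[u, v], continuous f}.
  by apply: derivable_within_continuous => t _; exact: ex_derive.
have [a0|a0] := leP 0 a.
  have [c + E] := MVT_segment a0 (fun t _ => hf t) (cf 0 a).
  rewrite in_itv /= => /andP[c0 ca]; exists c; last by rewrite E subr0.
  by rewrite !ger0_norm.
have [c + E] := MVT_segment (ltW a0) (fun t _ => hf t) (cf a 0).
rewrite in_itv /= => /andP[ac c0]; exists c; last by move: E; lra.
by rewrite !ler0_norm ?lerN2 // ltW.
Qed.

Lemma le_enorm_coord {R : realType} {k} (u v : 'cV[R]_k) :
  (forall i, `|u i 0| <= `|v i 0|) -> enorm u <= enorm v.
Proof.
move=> h; rewrite ler_wsqrtr // ler_sum // => i _.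
by rewrite -!expr2 -[leLHS]real_normK ?num_real // -[leRHS]real_normK ?num_real // ler_sqr ?nnegrE.
Qed.

(** The path from [x] to [x + z] changes one coordinate at a time: [tr k] keeps the first [k]
    coordinates of [z]. Each leg is a one-variable mean value theorem, and all points visited stay
    within [|z|] of [x]. *)
Lemma increment_bound {R : realType} {n} (h : 'cV[R]_n -> R) (x z : 'cV[R]_n) (e : R) :
  (forall (y : 'cV[R]_n) i, derivable (fun t : R => h (y + t *: evec R i)) 0 1) ->
  (forall (y : 'cV[R]_n) i, enorm (y - x) <= enorm z -> `|partial i h y - partial i h x| <= e) ->
  `|h (x + z) - h x - dotv (grad h x) z| <= n%:R * (e * enorm z).
Proof.
move=> dh he.
pose tr (k : nat) : 'cV[R]_n := \col_i (if (i < k)%N then z i 0 else 0).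
have e0 : (0 < n)%N -> 0 <= e.
  move=> n0; apply: le_trans (he x (Ordinal n0) _); first exact: normr_ge0.
  by rewrite subrr enorm0.
suff H (k : nat) : (k <= n)%N ->
    `|h (x + tr k) - h x - dotv (grad h x) (tr k)| <= k%:R * (e * enorm z).
  by have := H n (leqnn n); rewrite (_ : tr n = z) //; apply/colP => i; rewrite mxE ltn_ord.
elim: k => [_|k IH kn].
  rewrite (_ : tr 0%N = 0); last by apply/colP => i; rewrite !mxE.
  by rewrite addr0 subrr dotv0r subr0 normr0 mul0r.
pose i := Ordinal kn.
have trS : tr k.+1 = tr k + z i 0 *: evec R i.
  apply/colP => j; rewrite !mxE ltnS leq_eqVlt -val_eqE /= eqxx andbT.
  have [jk|jk] := eqVneq (j : nat) k.
    by rewrite jk ltnn add0r mulr1; congr (z _ 0); exact/val_inj.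
  by rewrite mulr0 addr0.
have [c cz E] := @MVT_from0 R (fun s : R => h (x + tr k + s *: evec R i)) _ (z i 0)
  (fun t => is_derive_partial h (x + tr k) i t (fun y => dh y i)).
have /(he _ i) pe : enorm ((x + tr k + c *: evec R i) - x) <= enorm z.
  rewrite -[x + _ + _]addrA [x + _]addrC addrK; apply: le_enorm_coord => j; rewrite !mxE eqxx andbT.
  have [->|ji] := eqVneq j i; first by rewrite ltnn add0r mulr1.
  by rewrite mulr0 addr0; case: ifP; rewrite ?normr0.
rewrite scale0r addr0 in E.
have -> : h (x + tr k.+1) - h x - dotv (grad h x) (tr k.+1) =
    (h (x + tr k) - h x - dotv (grad h x) (tr k))
    + (partial i h (x + tr k + c *: evec R i) - partial i h x) * z i 0.
  have -> : dotv (grad h x) (tr k.+1) = dotv (grad h x) (tr k) + partial i h x * z i 0.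
    rewrite trS dotvDr dotvZr; congr (_ + _); rewrite mulrC; congr (_ * _).
    rewrite /dotv (bigD1 i) //= big1 => [|j ji]; rewrite !mxE ?eqxx ?mulr1 ?addr0 //.
    by rewrite (negPf ji) mulr0.
  by rewrite trS addrA; move: E; lra.
apply: le_trans (ler_normD _ _) _.
rewrite -natr1 [leRHS]mulrDl mul1r lerD ?IH ?(ltnW kn) // normrM.
by rewrite ler_pM // normr_coord_le_enorm.
Qed.

Lemma ord_min_radius {R : realType} {n} (r : 'I_n -> R) :
  (forall i, 0 < r i) -> exists2 r0 : R, 0 < r0 & forall i, r0 <= r i.
Proof.
(* The default value [1] keeps the minimum positive when the index set is empty. *)
move=> rp; exists (\big[Num.min/1]_i r i); last by move=> i; exact: bigmin_le_cond.
by elim/big_ind: _ => // a b a0 b0; rewrite lt_min a0.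
Qed.

Lemma nbhs_forall_ord {R : realType} {k n} (x : 'cV[R]_k) (P : 'I_n -> set 'cV[R]_k) :
  (forall i, nbhs x (P i)) -> nbhs x [set y | forall i, P i y].
Proof.
move=> h.
have /choice[r hr] i : exists r : R, 0 < r /\ eball x r `<=` P i.
  by have /nbhs_eball[r r0 rP] := h i; exists r.
have [r0 r00 r0r] := ord_min_radius r (fun i => proj1 (hr i)).
apply/nbhs_eball; exists r0 => // y yr i; apply: (proj2 (hr i)).
by rewrite /eball /=; exact: lt_le_trans yr (r0r i).
Qed.

Lemma C1_expansion {R : realType} {n} (h : 'cV[R]_n -> R) (x : 'cV[R]_n) (e : R) :
  C1fun h -> 0 < e ->
  nbhs x [set y | `|h y - h x - dotv (grad h x) (y - x)| <= e * enorm (y - x)].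
Proof.
move=> [dh ch] e0; pose e' := e / n.+1%:R.
have e'0 : 0 < e' by rewrite divr_gt0 ?ltr0n.
have : nbhs x [set y | forall i, `|partial i h y - partial i h x| <= e'].
  apply: nbhs_forall_ord => i.
  have /nbhs_eball[r r0 hr] := ch i x _ (nbhsx_ballx _ _ e'0).
  apply/nbhs_eball; exists r => // y /hr /=.
  by rewrite -ball_normE /= distrC => /ltW.
move=> /nbhs_eball[r r0 hr]; apply/nbhs_eball; exists r => // y yr /=.
have := @increment_bound R n h x (y - x) e' dh; rewrite [x + (y - x)]addrC subrK => H.
apply: le_trans (H _) _.
  by move=> u i ux; apply: hr; exact: le_lt_trans ux yr.
rewrite mulrA ler_wpM2r // /e' mulrCA -[leRHS]mulr1 ler_wpM2l ?(ltW e0) //.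
by rewrite ler_pdivrMr ?ltr0n // mul1r ler_nat.
Qed.

(** The first-order expansion at [x + t z], restricted to increments [s z]; dividing by [1 + |z|]
    allows [z = 0]. *)
Lemma is_derive_line {R : realType} {n} (h : 'cV[R]_n -> R) (x z : 'cV[R]_n) (t : R) :
  C1fun h ->
  is_derive t 1 (fun s : R => h (x + s *: z)) (dotv (grad h (x + t *: z)) z).
Proof.
move=> ch; apply: is_derive_of_expansion => e e0.
have z1 : 0 < 1 + enorm z by rewrite ltr_pwDl.
have /nbhs_eball[r r0 hr] :=
  @C1_expansion R n h (x + t *: z) (e / (1 + enorm z)) ch (divr_gt0 e0 z1).
exists (r / (1 + enorm z)); first by rewrite divr_gt0.
move=> s sr; rewrite scalerDl addrA.
have E : x + t *: z + s *: z - (x + t *: z) = s *: z by rewrite addrC addKr.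
have := hr (x + t *: z + s *: z); rewrite /eball /= E enormZ dotvZr => H.
apply: le_trans (H _) _.
  apply: (@le_lt_trans _ _ (`|s| * (1 + enorm z))).
    by rewrite ler_wpM2l // ler_wpDl.
  by rewrite -ltr_pdivlMr.
rewrite mulrCA -[leRHS]mulrC ler_wpM2l // -[leRHS]mulr1 -mulrA ler_wpM2l ?(ltW e0) //.
by rewrite mulrC ler_pdivrMr // mul1r ler_wpDl.
Qed.

Lemma qformE {R : realType} {n} (H : 'M[R]_n) d : qform H d = dotv d (H *m d).
Proof.
by rewrite /qform -mulmxA mxE; apply: eq_bigr => i _; rewrite mxE.
Qed.

(** The mean value theorem on [[0, 1]] is applied to [psi], which is [h] along the segment minus its
    quadratic model. The derivative of [psi] pairs [z] with the first-order remainders of the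
    partial derivatives, each at most [e' |z|]. *)
Lemma C2_expansion {R : realType} {n} (h : 'cV[R]_n -> R) (x : 'cV[R]_n) (e : R) :
  C2fun h -> 0 < e -> exists2 r : R, 0 < r & forall z : 'cV[R]_n, enorm z < r ->
    `|h (x + z) - h x - dotv (grad h x) z - 2^-1 * qform (hess h x) z|
      <= e * enorm z ^+ 2.
Proof.
move=> [c1 c2] e0; pose e' := e / n.+1%:R.
have e'0 : 0 < e' by rewrite divr_gt0 ?ltr0n.
have : nbhs x [set y | forall i, `|partial i h y - partial i h x
    - dotv (grad (partial i h) x) (y - x)| <= e' * enorm (y - x)].
  by apply: nbhs_forall_ord => i; exact: C1_expansion.
move=> /nbhs_eball[r r0 hr]; exists r => // z zr.
pose q := qform (hess h x) z; pose a := dotv (grad h x) z.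
pose psi (t : R) := h (x + t *: z) - (t * a + 2^-1 * q * t ^+ 2).
pose dpsi (t : R) := dotv (grad h (x + t *: z)) z - (a + t * q).
have dpsiP (t : R) : is_derive t 1 psi (dpsi t).
  have dl := is_derive_line h x z t c1.
  apply: is_derive_eq; rewrite /dpsi /GRing.scale /=; lra.
have [c c1' E] := MVT_from0 psi dpsi 1 dpsiP.
rewrite normr1 in c1'.
have -> : h (x + z) - h x - dotv (grad h x) z - 2^-1 * qform (hess h x) z = dpsi c.
  move: E; rewrite mulr1 => <-; rewrite /psi scale1r scale0r addr0 -/a -/q; ring.
have -> : dpsi c = \sum_i (partial i h (x + c *: z) - partial i h x
    - dotv (grad (partial i h) x) (c *: z)) * z i 0.
  rewrite /dpsi /a /q qformE /dotv mulr_sumr -big_split -sumrB /=.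
  apply: eq_bigr => i _; rewrite !mxE.
  rewrite -/(dotv (grad (partial i h) x) (c *: z)) dotvZr.
  have -> : \sum_j hess h x i j * z j 0 = dotv (grad (partial i h) x) z.
    by apply: eq_bigr => j _; rewrite !mxE.
  ring.
apply: le_trans (ler_norm_sum _ _ _) _.
apply: (@le_trans _ _ (\sum_(i < n) e' * enorm z ^+ 2)).
  apply: ler_sum => i _; rewrite normrM expr2 mulrA ler_pM //.
    have := hr (x + c *: z); rewrite /eball /= addrC addKr enormZ => H.
    have cz : `|c| * enorm z <= enorm z by rewrite ler_piMl.
    apply: le_trans (H _ i) _; first exact: le_lt_trans cz zr.
    by rewrite ler_wpM2l // ltW.
  exact: normr_coord_le_enorm.
rewrite sumr_const card_ord -[_ *+ n]mulr_natr mulrAC ler_wpM2r ?sqr_ge0 // /e'.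
by rewrite mulrAC ler_pdivrMr ?ltr0n // ler_wpM2l ?ler_nat // ltW.
Qed.

(** * Gradient and Hessian of the Lagrangian *)

Lemma partial_lincomb {R : realType} {n m} (F : 'cV[R]_n -> R)
    (Gs : 'I_m -> 'cV[R]_n -> R) (lam : 'cV[R]_m) i (x : 'cV[R]_n) :
  derivable (fun t : R => F (x + t *: evec R i)) 0 1 ->
  (forall j, derivable (fun t : R => Gs j (x + t *: evec R i)) 0 1) ->
  partial i (fun y => F y + \sum_j Gs j y * lam j 0) x =
  partial i F x + \sum_j partial i (Gs j) x * lam j 0.
Proof.
move=> dF dG; rewrite /partial.
under [in RHS]eq_bigr do rewrite derive1E; rewrite !derive1E.
have iF : is_derive (0 : R) 1 (fun t : R => F (x + t *: evec R i))
  ('D_1 (fun t : R => F (x + t *: evec R i)) 0) by exact: DeriveDef.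
have iG j : is_derive (0 : R) 1 (lam j 0 \*: (fun t : R => Gs j (x + t *: evec R i)))
   (lam j 0 *: 'D_1 (fun t : R => Gs j (x + t *: evec R i)) 0).
  by apply: is_deriveZ; exact: DeriveDef.
have := is_deriveD iF (is_derive_sum iG) => -[_ E].
rewrite (_ : (fun t : R => _ + _) = (fun t : R => F (x + t *: evec R i)) +
   \sum_j (lam j 0 \*: (fun t : R => Gs j (x + t *: evec R i)))).
  by rewrite E; congr (_ + _); apply: eq_bigr => j _; rewrite mulrC.
apply/funext => t /=; rewrite -[RHS]/(_ + _) fct_sumE; congr (_ + _).
by apply: eq_bigr => j _; rewrite mulrC.
Qed.

Lemma partial_lagr {R : realType} {n m} (f : 'cV[R]_n -> R)
    (g : 'cV[R]_n -> 'cV[R]_m) (lam : 'cV[R]_m) i (x : 'cV[R]_n) :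
  C2fun f -> C2map g ->
  partial i (fun y => lagr f g y lam) x =
  partial i f x + \sum_j partial i (fun y => g y j 0) x * lam j 0.
Proof.
move=> [[df _] _] cg; apply: (@partial_lincomb R n m f (fun j y => g y j 0)) => [|j].
  exact: df.
by have [[dg _] _] := cg j; exact: dg.
Qed.

Lemma grad_lagr {R : realType} {n m} (f : 'cV[R]_n -> R)
    (g : 'cV[R]_n -> 'cV[R]_m) (lam : 'cV[R]_m) (x : 'cV[R]_n) :
  C2fun f -> C2map g ->
  grad (fun y => lagr f g y lam) x = grad f x + (jac g x)^T *m lam.
Proof.
move=> cf cg; apply/colP => i; rewrite !mxE partial_lagr //; congr (_ + _).
by apply: eq_bigr => j _; rewrite !mxE.
Qed.

Lemma qform_hess_lagr {R : realType} {n m} (f : 'cV[R]_n -> R)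
    (g : 'cV[R]_n -> 'cV[R]_m) (lam : 'cV[R]_m) (x d : 'cV[R]_n) :
  C2fun f -> C2map g ->
  qform (hess (fun y => lagr f g y lam) x) d =
  qform (hess f x) d + dotv lam (hess2 g x d).
Proof.
move=> cf cg.
have -> : hess (fun y => lagr f g y lam) x =
    hess f x + \sum_j lam j 0 *: hess (fun y => g y j 0) x.
  apply/matrixP => i k; rewrite !mxE summxE.
  rewrite (_ : partial i _ = fun y => partial i f y +
     \sum_j partial i (fun y => g y j 0) y * lam j 0); last first.
    by apply/funext => y; exact: partial_lagr.
  (* The rule for linear combinations is applied a second time, now to the first partial
     derivatives. *)
  rewrite (@partial_lincomb R n m (partial i f) (fun j => partial i (fun y => g y j 0))).
  - by congr (_ + _); apply: eq_bigr => j _; rewrite !mxE mulrC.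
  - by have [_ /(_ i)[H _]] := cf; exact: H.
  - by move=> j; have [_ /(_ i)[H _]] := cg j; exact: H.
rewrite /qform mulmxDr mulmxDl [LHS]mxE; congr (_ + _).
rewrite mulmx_sumr mulmx_suml summxE; apply: eq_bigr => j _.
by rewrite -scalemxAr -scalemxAl [in LHS]mxE [hess2 _ _ _ _ _]mxE.
Qed.

(** The curvature term is [t^2 / 2] times the Hessian form at [d]. Since [t^2 = (t / s) t s] and
    [t / s] is close to [theta], it joins the term of [w] on the scale [t s / 2] with weight
    [theta]. The radius is uniform in [|w| <= C]. *)
Lemma path_expansion {R : realType} {n} (h : 'cV[R]_n -> R) (x d : 'cV[R]_n) (theta C e : R) :
  C2fun h -> 0 <= theta -> 0 <= C -> 0 < e ->
  exists2 r : R, 0 < r & forall (t s : R) (w : 'cV[R]_n), 0 < t < r -> 0 < s < r ->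
    `|t / s - theta| < r -> enorm w <= C ->
    `|h (x + t *: d + (2^-1 * t * s) *: w) - h x - t * dotv (grad h x) d
      - 2^-1 * t * s * (dotv (grad h x) w + theta * qform (hess h x) d)| <= e * (t * s).
Proof.
move=> ch th0 C0 e0.
pose H := hess h x; pose B := enorm d + C.
have B0 : 0 <= B by rewrite addr_ge0.
have [M [M0 hM]] := mulmx_bounded H.
pose T := theta + 1; have T0 : 0 < T by rewrite ltr_wpDl.
have D0 : 0 < 1 + T * B ^+ 2 by rewrite ltr_pwDl // mulr_ge0 ?sqr_ge0 // ltW.
pose e1 := e / 3 / (1 + T * B ^+ 2).
have e10 : 0 < e1 by rewrite !divr_gt0.
have [r1 r10 hr1] := @C2_expansion R n h x e1 ch e10.
pose Q := 1 + T * M * C * B + `|qform H d|.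
have Q0 : 0 < Q.
  by rewrite /Q -addrA ltr_pwDl // addr_ge0 // !mulr_ge0 // ltW.
(* Three errors of at most [e / 3] each, relative to [t s]: the Taylor remainder, the deviation of
   [t / s] from [theta], and the Hessian terms containing [w]. *)
pose r := Num.min 1 (Num.min (r1 / (1 + B)) (e / 3 / Q)).
have B1 : 0 < 1 + B by rewrite ltr_pwDl.
have r0 : 0 < r by rewrite !lt_min ltr01 !divr_gt0.
exists r => // t s w /andP[t0 tr] /andP[s0 sr] tsr wC.
move: tr sr tsr; rewrite !lt_min => /and3P[t1 tr1 tQ] /and3P[s1 _ sQ] /and3P[q1 _ qQ].
pose u := d + (2^-1 * s) *: w.
have zE : t *: d + (2^-1 * t * s) *: w = t *: u.
  by rewrite /u scalerDr scalerA; congr (_ + _ *: _); ring.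
have uB : enorm u <= B.
  apply: le_trans (ler_enormD _ _) _; rewrite lerD2l enormZ ger0_norm; last by nra.
  by have := enorm_ge0 w; nra.
have tu : enorm (t *: u) < r1.
  rewrite enormZ gtr0_norm //; move: tr1; rewrite ltr_pdivlMr // => tr1.
  by have := enorm_ge0 u; nra.
have tsT : t <= T * s.
  have : t / s < T by move: q1; rewrite ltr_norml /T; lra.
  by rewrite ltr_pdivrMr // => /ltW.
have rem := hr1 _ tu; rewrite -[x + _ + _]addrA zE.
have b1 : e1 * enorm (t *: u) ^+ 2 <= e / 3 * (t * s).
  rewrite enormZ gtr0_norm // exprMn.
  have -> : e / 3 * (t * s) = e1 * ((1 + T * B ^+ 2) * (t * s)).
    by rewrite /e1; field; rewrite gt_eqF.
  rewrite ler_pM2l //.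
  have u2 : enorm u ^+ 2 <= B ^+ 2 by rewrite ler_sqr ?nnegrE.
  have ts0 : 0 < t * s by rewrite mulr_gt0.
  apply: (@le_trans _ _ (t ^+ 2 * B ^+ 2)); first by rewrite ler_pM2l // exprn_gt0.
  have : t ^+ 2 <= T * (t * s) by nra.
  have := sqr_ge0 B; nra.
have qE : qform H (t *: u) = t ^+ 2 * qform H d
   + t ^+ 2 * (2^-1 * s * (dotv d (H *m w) + dotv w (H *m u))).
  rewrite !qformE /u -!scalemxAr !dotvE !mulmxDr -!scalemxAr !dotvE; ring.
have b2 : `|dotv d (H *m w) + dotv w (H *m u)| <= 2 * (M * C * B).
  apply: le_trans (ler_normD _ _) _.
  have := normr_dotv_le d (H *m w); have := normr_dotv_le w (H *m u).
  have := hM w; have := hM u.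
  have d0 := enorm_ge0 d; have w0 := enorm_ge0 w; have u0 := enorm_ge0 u.
  have dB : enorm d <= B by rewrite /B lerDl.
  move=> h1 h2 h3 h4.
  have k1 : enorm w * enorm (H *m u) <= C * (M * B).
    by rewrite ler_pM //; apply: le_trans h1 _; rewrite ler_pM2l.
  have k2 : enorm d * enorm (H *m w) <= B * (M * C).
    by rewrite ler_pM //; apply: le_trans h2 _; rewrite ler_pM2l.
  lra.
have gE : dotv (grad h x) (t *: u) = t * dotv (grad h x) d
    + 2^-1 * t * s * dotv (grad h x) w.
  by rewrite /u !dotvE; ring.
rewrite -/H qE gE in rem.
set L := h (x + t *: u) in rem *; set G1 := dotv (grad h x) d in rem *.
set G2 := dotv (grad h x) w in rem *; set q := qform H d in rem *.
set X := dotv d (H *m w) + dotv w (H *m u) in rem b2.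
have -> : L - h x - t * G1 - 2^-1 * t * s * (G2 + theta * q) =
   (L - h x - (t * G1 + 2^-1 * t * s * G2)
      - 2^-1 * (t ^+ 2 * q + t ^+ 2 * (2^-1 * s * X)))
   + (2^-1 * (t * s) * ((t / s - theta) * q) + 4^-1 * s * t ^+ 2 * X).
  by field; rewrite gt_eqF.
apply: le_trans (ler_normD _ _) _.
apply: le_trans (lerD (le_trans rem b1) (ler_normD _ _)) _.
have ts0 : 0 < t * s by rewrite mulr_gt0.
have b3 : `|2^-1 * (t * s) * ((t / s - theta) * q)| <= e / 3 * (t * s).
  rewrite !normrM (gtr0_norm t0) (gtr0_norm s0) gtr0_norm //.
  have : `|t / s - theta| * `|q| <= e / 3.
    move: qQ; rewrite ltr_pdivlMr // => qQ; apply: le_trans (ltW qQ).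
    rewrite ler_wpM2l // /Q ler_wpDl // addr_ge0 // !mulr_ge0 // ltW //.
  nra.
have b4 : `|4^-1 * s * t ^+ 2 * X| <= e / 3 * (t * s).
  rewrite normrM ger0_norm; last by rewrite !mulr_ge0 ?sqr_ge0 // ltW.
  have : s * (T * M * C * B) <= e / 3.
    move: sQ; rewrite ltr_pdivlMr // => sQ; apply: le_trans (ltW sQ).
    rewrite ler_pM2l // /Q -addrA [1 + _]addrC -addrA lerDl; exact: addr_ge0.
  move=> k1.
  have k2 : t ^+ 2 <= T * (t * s) by nra.
  apply: (@le_trans _ _ (4^-1 * s * (T * (t * s)) * (2 * (M * C * B)))).
    rewrite ler_pM //; first by rewrite !mulr_ge0 ?sqr_ge0 // ltW.
    by rewrite ler_pM2l // mulr_gt0.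
  have -> : 4^-1 * s * (T * (t * s)) * (2 * (M * C * B)) =
     2^-1 * (s * (T * M * C * B)) * (t * s) by field.
  rewrite ler_pM2r //; lra.
by move: b3 b4; lra.
Qed.

Lemma path_expansion_map {R : realType} {n m} (g : 'cV[R]_n -> 'cV[R]_m)
    (x d : 'cV[R]_n) (theta C e : R) :
  C2map g -> 0 <= theta -> 0 <= C -> 0 < e ->
  exists2 r : R, 0 < r & forall (t s : R) (w : 'cV[R]_n), 0 < t < r -> 0 < s < r ->
    `|t / s - theta| < r -> enorm w <= C ->
    enorm (g (x + t *: d + (2^-1 * t * s) *: w) - (g x + t *: (jac g x *m d)
      + (2^-1 * t * s) *: (jac g x *m w + theta *: hess2 g x d))) <= e * (t * s).
Proof.
move=> cg th0 C0 e0; pose e' := e / m.+1%:R.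
have e'0 : 0 < e' by rewrite divr_gt0 ?ltr0n.
have /choice[r hr] : forall j : 'I_m, exists r : R, 0 < r /\ forall (t s : R) (w : 'cV[R]_n),
    0 < t < r -> 0 < s < r -> `|t / s - theta| < r -> enorm w <= C ->
    `|g (x + t *: d + (2^-1 * t * s) *: w) j 0 - g x j 0 - t * dotv (grad (fun y => g y j 0) x) d
      - 2^-1 * t * s * (dotv (grad (fun y => g y j 0) x) w
          + theta * qform (hess (fun y => g y j 0) x) d)| <= e' * (t * s).
  move=> j; have [r r0 h] :=
    @path_expansion R n (fun y => g y j 0) x d theta C e' (cg j) th0 C0 e'0.
  by exists r.
have [r0 r00 rj] := ord_min_radius r (fun j => proj1 (hr j)).
exists r0 => // t s w /andP[t0 tr] /andP[s0 sr] tsr wC.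
apply: le_trans (enorm_le_sum _) _.
apply: (@le_trans _ _ (\sum_(j < m) e' * (t * s))).
  apply: ler_sum => j _; have [_ h] := hr j.
  have := h t s w; rewrite t0 s0 !(lt_le_trans _ (rj j)) // => /(_ isT isT isT wC).
  have gE u : (jac g x *m u) j 0 = dotv (grad (fun y => g y j 0) x) u.
    by rewrite mxE; apply: eq_bigr => i _; rewrite !mxE.
  rewrite !mxE -!gE [X in `|X - _|]lock !mxE -lock => H.
  apply: le_trans H; rewrite le_eqVlt; apply/orP; left; apply/eqP; congr `|_|.
  by ring.
rewrite sumr_const card_ord -[_ *+ m]mulr_natr mulrAC /e'.
rewrite ler_wpM2r ?mulr_ge0 ?(ltW t0) ?(ltW s0) //.
by rewrite mulrAC ler_pdivrMr ?ltr0n // ler_wpM2l ?ler_nat // ltW.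
Qed.

(** * Tangent sets and normals *)

(** Membership asks for one triple within each tolerance instead of sequences, so closedness and
    cluster arguments need no diagonal extraction. *)
Definition gtan {R : realType} {k} (theta : R) (A : set 'cV[R]_k)
    (x d : 'cV[R]_k) : set 'cV[R]_k :=
  [set w | forall e : R, 0 < e -> exists (t s : R) (w' : 'cV[R]_k),
     [/\ 0 < t < e, 0 < s < e, `|t / s - theta| < e, enorm (w' - w) < e &
         A (x + t *: d + (2^-1 * t * s) *: w')]].

Lemma cvg_r_invS {R : realType} (a : nat -> R) (l : R) :
  (forall j, `|a j - l| < j.+1%:R^-1) -> a j @[j --> \oo] --> l.
Proof.
move=> h; apply/cvg_rP => e e0; have [N hN] := invS_lt e e0.
by exists N => j Nj; exact: lt_trans (h j) (hN j Nj).
Qed.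

Lemma cvg_enorm_invS {R : realType} {k} (a : nat -> 'cV[R]_k) (l : 'cV[R]_k) :
  (forall j, enorm (a j - l) < j.+1%:R^-1) -> a j @[j --> \oo] --> l.
Proof.
move=> h; apply/cvg_enormP => e e0; have [N hN] := invS_lt e e0.
by exists N => j Nj; exact: lt_trans (h j) (hN j Nj).
Qed.

Lemma pos_to0_invS {R : realType} (t : nat -> R) :
  (forall j, 0 < t j < j.+1%:R^-1) -> pos_to0 t.
Proof.
move=> h; split=> [j|]; first by have /andP[] := h j.
by apply: cvg_r_invS => j; have /andP[t0 tj] := h j; rewrite subr0 gtr0_norm.
Qed.

Lemma pos_to0_lt {R : realType} (t : nat -> R) (e : R) : pos_to0 t -> 0 < e ->
  exists N, forall j, (N <= j)%N -> 0 < t j < e.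
Proof.
move=> [t0 /cvg_rP h] e0; have [N hN] := h e e0; exists N => j /hN.
by rewrite subr0 t0 gtr0_norm.
Qed.

Lemma tangentpp_gtan {R : realType} {k} (A : set 'cV[R]_k) (x d : 'cV[R]_k) :
  tangentpp A x d = gtan 0 A x d.
Proof.
apply/seteqP; split=> w.
  move=> [t [r [wk [t0 [r0 [tr [wkw Aw]]]]]]] e e0.
  have [N1 h1] := pos_to0_lt t e t0 e0; have [N2 h2] := pos_to0_lt r e r0 e0.
  have [N3 h3] := proj1 (cvg_rP _ _) tr e e0.
  have [N4 h4] := proj1 (cvg_enormP _ _) wkw e e0.
  pose j := maxn (maxn N1 N2) (maxn N3 N4).
  exists (t j), (r j), (wk j); split.
  - by apply: h1; rewrite !leq_max leqnn.
  - by apply: h2; rewrite !leq_max leqnn orbT.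
  - by apply: h3; rewrite !leq_max leqnn !orbT.
  - by apply: h4; rewrite !leq_max leqnn !orbT.
  - exact: Aw.
move=> h.
have /eps_choice[z hz] : forall e : R, 0 < e -> exists z : R * R * 'cV[R]_k,
    [/\ 0 < z.1.1 < e, 0 < z.1.2 < e, `|z.1.1 / z.1.2 - 0| < e, enorm (z.2 - w) < e &
         A (x + z.1.1 *: d + (2^-1 * z.1.1 * z.1.2) *: z.2)].
  by move=> e /h[t [s [w' H]]]; exists (t, s, w').
exists (fun j => (z j).1.1), (fun j => (z j).1.2), (fun j => (z j).2).
split; first by apply: pos_to0_invS => j; have [] := hz j.
split; first by apply: pos_to0_invS => j; have [] := hz j.
split; first by apply: cvg_r_invS => j; have [] := hz j.
split; first by apply: cvg_enorm_invS => j; have [] := hz j.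
by move=> j; have [] := hz j.
Qed.

(** Only the inclusion from [gtan 1] needs work: there [s] may differ from [t], and replacing [w']
    by [(s / t) w'] gives the same point with factor [t^2 / 2]. As [s / t] tends to [1], the limit
    is unchanged. *)
Lemma tangent2_gtan {R : realType} {k} (A : set 'cV[R]_k) (x d : 'cV[R]_k) :
  tangent2 A x d = gtan 1 A x d.
Proof.
apply/seteqP; split=> w.
  move=> [t [wk [t0 [wkw Aw]]]] e e0.
  have [N1 h1] := pos_to0_lt t e t0 e0.
  have [N4 h4] := proj1 (cvg_enormP _ _) wkw e e0.
  pose j := maxn N1 N4; have [tj _] := t0.
  exists (t j), (t j), (wk j); split.
  - by apply: h1; rewrite leq_max leqnn.
  - by apply: h1; rewrite leq_max leqnn.
  - by rewrite divff ?gt_eqF // subrr normr0.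
  - by apply: h4; rewrite leq_max leqnn orbT.
  - by have := Aw j; rewrite expr2 mulrA.
move=> h.
have /eps_choice[z hz] : forall e : R, 0 < e -> exists z : R * 'cV[R]_k,
    [/\ 0 < z.1 < e, enorm (z.2 - w) < e &
         A (x + z.1 *: d + (2^-1 * z.1 ^+ 2) *: z.2)].
  move=> e e0; pose W := enorm w + 2.
  have W0 : 0 < W by rewrite ltr_wpDl.
  (* The bound [1/2] forces [s / t <= 2], hence [|s / t - 1| <= 2 e']; [W] bounds [|w'|], and the
     total error [2 e' W + e'] stays below [e]. *)
  pose e' := Num.min (2^-1 : R) (e / (4 * W)).
  have e'0 : 0 < e' by rewrite lt_min invr_gt0 ltr0n divr_gt0 // mulr_gt0.
  have e'2 : e' <= 2^-1 by rewrite ge_min lexx.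
  have e'W : 4 * (e' * W) <= e.
    rewrite mulrCA -[leRHS](@divfK _ (4 * W)) ?gt_eqF ?mulr_gt0 //.
    by rewrite ler_pM2r ?mulr_gt0 // ge_min lexx orbT.
  have [t [s [w' [/andP[t0 te] /andP[s0 se] ts w'w Aw]]]] := h e' e'0.
  exists (t, (s / t) *: w'); split => /=.
  - by rewrite t0 /=; have := enorm_ge0 w; rewrite /W in e'W; nra.
  - have st : `|s / t - 1| <= 2 * e'.
      have tE : t = t / s * s by rewrite divfK // gt_eqF.
      have r2 : 2^-1 < t / s by move: ts; rewrite ltr_norml; lra.
      have -> : s / t - 1 = (1 - t / s) * (s / t) by field; rewrite !gt_eqF.
      have st2 : s / t <= 2 by rewrite ler_pdivrMr //; nra.
      rewrite normrM distrC (gtr0_norm (divr_gt0 s0 t0)) mulrC.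
      by rewrite ler_pM // ?divr_ge0 // ltW.
    have -> : (s / t) *: w' - w = (s / t - 1) *: w' + (w' - w).
      by rewrite scalerBl scale1r addrA subrK.
    apply: le_lt_trans (ler_enormD _ _) _; rewrite enormZ.
    have w'W : enorm w' <= W by have := ler_enormBD w' w; rewrite /W; lra.
    have := ler_pM (normr_ge0 _) (enorm_ge0 _) st w'W.
    have := enorm_ge0 w; rewrite /W in e'W *; nra.
  - rewrite scalerA (_ : 2^-1 * t ^+ 2 * (s / t) = 2^-1 * t * s) //.
    by field; rewrite gt_eqF.
exists (fun j => (z j).1), (fun j => (z j).2).
split; first by apply: pos_to0_invS => j; have [] := hz j.
split; first by apply: cvg_enorm_invS => j; have [] := hz j.
by move=> j; have [] := hz j.
Qed.

Lemma tangent_coneP {R : realType} {k} (A : set 'cV[R]_k) (x d : 'cV[R]_k) :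
  tangent_cone A x d <-> forall e : R, 0 < e -> exists (t : R) (d' : 'cV[R]_k),
     [/\ 0 < t < e, enorm (d' - d) < e & A (x + t *: d')].
Proof.
split=> [[t [dk [t0 [dkd Ad]]]] e e0|h].
  have [N1 h1] := pos_to0_lt t e t0 e0.
  have [N2 h2] := proj1 (cvg_enormP _ _) dkd e e0.
  exists (t (maxn N1 N2)), (dk (maxn N1 N2)); split => //.
  - by apply: h1; rewrite leq_max leqnn.
  - by apply: h2; rewrite leq_max leqnn orbT.
have /eps_choice[z hz] : forall e : R, 0 < e -> exists z : R * 'cV[R]_k,
    [/\ 0 < z.1 < e, enorm (z.2 - d) < e & A (x + z.1 *: z.2)].
  by move=> e /h[t [d' H]]; exists (t, d').
exists (fun j => (z j).1), (fun j => (z j).2).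
split; first by apply: pos_to0_invS => j; have [] := hz j.
split; first by apply: cvg_enorm_invS => j; have [] := hz j.
by move=> j; have [] := hz j.
Qed.

Lemma tangent_cone0 {R : realType} {k} (A : set 'cV[R]_k) (x : 'cV[R]_k) :
  A x -> tangent_cone A x 0.
Proof.
move=> Ax; apply/tangent_coneP => e e0; exists (e / 2), 0; split.
- by apply/andP; split; lra.
- by rewrite subrr enorm0.
- by rewrite scaler0 addr0.
Qed.

Lemma dir_normal_approx {R : realType} {k} (A : set 'cV[R]_k) (x d v : 'cV[R]_k) :
  (forall e : R, 0 < e -> exists (t : R) (d' v' : 'cV[R]_k),
     [/\ 0 < t < e, enorm (d' - d) < e, enorm (v' - v) < e &
         frechet_normal A (x + t *: d') v']) ->
  dir_normal A x d v.
Proof.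
move=> h.
have /eps_choice[z hz] : forall e : R, 0 < e -> exists z : R * 'cV[R]_k * 'cV[R]_k,
    [/\ 0 < z.1.1 < e, enorm (z.1.2 - d) < e, enorm (z.2 - v) < e &
        frechet_normal A (x + z.1.1 *: z.1.2) z.2].
  by move=> e /h[t [d' [v' H]]]; exists (t, d', v').
exists (fun j => (z j).1.1), (fun j => (z j).1.2), (fun j => (z j).2).
split; first by apply: pos_to0_invS => j; have [] := hz j.
split; first by apply: cvg_enorm_invS => j; have [] := hz j.
split; first by apply: cvg_enorm_invS => j; have [] := hz j.
by move=> j; have [] := hz j.
Qed.

Lemma limiting_normal_approx {R : realType} {k} (A : set 'cV[R]_k) (x v : 'cV[R]_k) :
  (forall e : R, 0 < e -> exists x' v' : 'cV[R]_k,
     [/\ enorm (x' - x) < e, enorm (v' - v) < e & frechet_normal A x' v']) ->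
  limiting_normal A x v.
Proof.
move=> h.
have /eps_choice[z hz] : forall e : R, 0 < e -> exists z : 'cV[R]_k * 'cV[R]_k,
    [/\ enorm (z.1 - x) < e, enorm (z.2 - v) < e & frechet_normal A z.1 z.2].
  by move=> e /h[x' [v' H]]; exists (x', v').
exists (fun j => (z j).1), (fun j => (z j).2).
split; first by move=> j; have [_ _ []] := hz j.
split; first by apply: cvg_enorm_invS => j; have [] := hz j.
split; first by apply: cvg_enorm_invS => j; have [] := hz j.
by move=> j; have [] := hz j.
Qed.

Lemma gtan_closed {R : realType} {k} (theta : R) (A : set 'cV[R]_k) (x d : 'cV[R]_k) :
  closed (gtan theta A x d).
Proof.
apply/closed_enormP => w h e e0; have e2 : 0 < e / 2 by lra.
have [a ga aw] := h _ e2.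
have [t [s [w' [/andP[t0 te] /andP[s0 se] ts w'a Aw]]]] := ga _ e2.
exists t, s, w'; split => //.
- by rewrite t0; lra.
- by rewrite s0; lra.
- by apply: lt_trans ts _; lra.
- by apply: le_lt_trans (ler_enorm_dist a _ _) _; lra.
Qed.

(** * Proximal normals and second-order tangent sets *)

Lemma nearest_point_dotv {R : realType} {k} (A : set 'cV[R]_k) (x v a : 'cV[R]_k) (tau : R) :
  nearest_point A x (x + tau *: v) -> A a ->
  2 * tau * dotv v (a - x) <= enorm (a - x) ^+ 2.
Proof.
move=> [_ h] /h; rewrite addrC addKr => ha.
have : enorm (tau *: v) ^+ 2 <= enorm (x + tau *: v - a) ^+ 2.
  by rewrite ler_sqr ?nnegrE.
have -> : x + tau *: v - a = tau *: v - (a - x).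
  by vec_ring.
move: (a - x) => u; rewrite !sqr_enorm !dotvE (dotvC u v); lra.
Qed.

Lemma prox_frechet {R : realType} {k} (A : set 'cV[R]_k) (x v : 'cV[R]_k) :
  prox_normal A x v -> frechet_normal A x v.
Proof.
move=> [tau [tau0 hn]]; split; first by case: hn.
(* On this radius the quadratic bound [|y - x|^2 / (2 tau)] is at most [eta |y - x|]. *)
move=> eta eta0; exists (2 * tau * eta); split; first by rewrite !mulr_gt0.
move=> y Ay /andP[y0 yr].
have := nearest_point_dotv A x v y tau hn Ay.
have t2 : 0 < 2 * tau by rewrite mulr_gt0.
move=> H; rewrite -(ler_pM2l t2); apply: le_trans H _.
by rewrite expr2 mulrA ler_pM2r // ltW.
Qed.

(** If the deviations [d' - d] can be kept of order [t], the vectors [2 (d' - d) / t] are bounded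
    and cluster in [gtan 1]. Otherwise [|d' - d| / t] is unbounded for small [t]; with
    [s = 2 |d' - d|] the unit vectors along [d' - d] cluster in [gtan 0]. *)
Lemma tangent_dichotomy {R : realType} {k} (A : set 'cV[R]_k) (x d : 'cV[R]_k) :
  tangent_cone A x d -> gtan 1 A x d !=set0 \/ gtan 0 A x d !=set0.
Proof.
move=> /tangent_coneP h.
have [[C hC]|nC] := pselect (exists C : R, forall e : R, 0 < e ->
    exists (t : R) (d' : 'cV[R]_k), [/\ 0 < t < e, enorm (d' - d) <= C * t & A (x + t *: d')]).
  left; pose P (e : R) (w : 'cV[R]_k) :=
    exists2 t : R, 0 < t < e & A (x + t *: d + (2^-1 * t * t) *: w).
  have [||w0 [_ hw0]] := @bounded_cluster R k P (2 * C).
  - move=> e e' w ee' [t /andP[t0 te] Aw]; exists t => //.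
    by rewrite t0 (lt_le_trans te).
  - move=> e /hC[t [d' [/andP[t0 te] dC Ad]]]; exists ((2 / t) *: (d' - d)); split.
      rewrite enormZ gtr0_norm ?divr_gt0 // mulrAC ler_pdivrMr //; lra.
    exists t; rewrite ?t0 //.
    rewrite scalerA (_ : 2^-1 * t * t * (2 / t) = t); last by field; rewrite gt_eqF.
    by rewrite (_ : x + _ + _ = x + t *: d') //; vec_ring.
  exists w0 => e e0; have [w [ww0 [t tt Aw]]] := hw0 e e0.
  exists t, t, w; split => //.
  by have /andP[t0 _] := tt; rewrite divff ?gt_eqF // subrr normr0.
right; pose P (e : R) (w : 'cV[R]_k) := exists t s : R,
  [/\ 0 < t < e, 0 < s < e, `|t / s - 0| < e & A (x + t *: d + (2^-1 * t * s) *: w)].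
have [||w0 [_ hw0]] := @bounded_cluster R k P 1.
- move=> e e' w ee' [t [s [/andP[t0 te] /andP[s0 se] ts Aw]]]; exists t, s; split => //.
  + by rewrite t0 (lt_le_trans te).
  + by rewrite s0 (lt_le_trans se).
  + exact: lt_le_trans ts ee'.
- move=> e e0.
  have [e1 e10 he1] : exists2 e1 : R, 0 < e1 & forall (t : R) (d' : 'cV[R]_k),
      0 < t < e1 -> A (x + t *: d') -> e^-1 * t < enorm (d' - d).
    apply: contrapT => H; apply: nC; exists e^-1 => e1 e10.
    apply: contrapT => H'; apply: H; exists e1 => // t d' te Ad.
    by rewrite ltNge; apply/negP => dl; apply: H'; exists t, d'; split.
  pose e2 := Num.min e1 (Num.min e (e / 2)).
  have [|t [d' [/andP[t0 te] dd Ad]]] := h e2.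
    by rewrite !lt_min e10 e0 divr_gt0.
  move: te dd; rewrite !lt_min => /and3P[te1 te _] /and3P[_ _ dde].
  have te1' : 0 < t < e1 by rewrite t0.
  have := he1 t d' te1' Ad; set D := enorm (d' - d) => tD.
  have D0 : 0 < D by apply: le_lt_trans tD; rewrite mulr_ge0 ?invr_ge0 // ltW.
  exists (D^-1 *: (d' - d)); split.
    by rewrite enormZ gtr0_norm ?invr_gt0 // -/D mulVf // gt_eqF.
  exists t, (2 * D); split.
  + by rewrite t0.
  + by rewrite mulr_gt0 //=; rewrite /D in dde *; lra.
  + rewrite subr0 gtr0_norm ?divr_gt0 ?mulr_gt0 // ltr_pdivrMr ?mulr_gt0 //.
    by move: tD; rewrite mulrC ltr_pdivrMr // => tD; nra.
  + rewrite scalerA (_ : 2^-1 * t * (2 * D) * D^-1 = t); last by field; rewrite gt_eqF.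
    by rewrite (_ : x + _ + _ = x + t *: d') //; vec_ring.
exists w0 => e e0; have [w [ww0 [t [s [ht hs hts Aw]]]]] := hw0 e e0.
by exists t, s, w.
Qed.

(** The point [z = v + sg mu] is carried to the scale of [K] as [pt t s z] and projected onto [K].
    The rescaled projections [p] cluster at a point of the outer limit no farther from [z] than [v],
    which must be [v]. Then [(z - p) / sg] is a proximal normal to [K] and tends to [mu]. *)
Lemma gtan_prox_dir {R : realType} {k} (theta : R) (K : set 'cV[R]_k)
    (y d v mu : 'cV[R]_k) (e : R) :
  closed K -> prox_normal (gtan theta K y d) v mu -> 0 < e ->
  exists (t : R) (d' mu' : 'cV[R]_k),
    [/\ 0 < t < e, enorm (d' - d) < e, enorm (mu' - mu) < e &
        frechet_normal K (y + t *: d') mu'].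
Proof.
move=> cK [tau [tau0 hn]] e0.
(* Halving the proximal step makes [v] the only nearest point to [z]. *)
pose sg := tau / 2; have sg0 : 0 < sg by rewrite divr_gt0.
pose z := v + sg *: mu.
have Dv : gtan theta K y d v by case: hn.
pose pt (t s : R) (p : 'cV[R]_k) := y + t *: d + (2^-1 * t * s) *: p.
have ptB (t s : R) (p q : 'cV[R]_k) : 0 < t -> 0 < s ->
    enorm (pt t s p - pt t s q) = 2^-1 * t * s * enorm (p - q).
  move=> t0 s0; rewrite /pt opprD addrACA subrr add0r -scalerBr enormZ gtr0_norm //.
  by rewrite !mulr_gt0 ?invr_gt0.
pose P (r : R) (p : 'cV[R]_k) := exists t s : R,
  [/\ 0 < t < r, 0 < s < r, `|t / s - theta| < r,
      nearest_point K (pt t s p) (pt t s z) & enorm (z - p) <= sg * enorm mu + r].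
have [||p0 [_ hp0]] := @bounded_cluster R k P (enorm z + (sg * enorm mu + 1)).
- move=> r r' p rr' [t [s [/andP[t0 te] /andP[s0 se] ts H1 H2]]]; exists t, s; split => //.
  + by rewrite t0 (lt_le_trans te).
  + by rewrite s0 (lt_le_trans se).
  + exact: lt_le_trans ts rr'.
  + by apply: le_trans H2 _; rewrite lerD2l.
- move=> r r0; pose r1 := Num.min r 1.
  have r10 : 0 < r1 by rewrite lt_min r0 ltr01.
  have r1r : r1 <= r by rewrite ge_min lexx.
  have r11 : r1 <= 1 by rewrite ge_min lexx orbT.
  have [t [s [v' [/andP[t0 te] /andP[s0 se] ts v'v Kv']]]] := Dv r1 r10.
  have [q hq] := nearest_point_exists K (pt t s z) cK (ex_intro _ _ Kv').
  pose p := (2^-1 * t * s)^-1 *: (q - (y + t *: d)).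
  have qE : pt t s p = q.
    rewrite /pt /p scalerA divff ?gt_eqF ?mulr_gt0 ?invr_gt0 //.
    by rewrite scale1r addrC subrK.
  have zp : enorm (z - p) <= sg * enorm mu + r1.
    have [_ /(_ _ Kv')] := hq; rewrite -qE -/(pt t s v') !ptB //.
    rewrite ler_pM2l ?mulr_gt0 ?invr_gt0 // => /le_trans; apply.
    have -> : z - v' = sg *: mu + (v - v') by rewrite /z; vec_ring.
    apply: le_trans (ler_enormD _ _) _; rewrite enormZ gtr0_norm // lerD2l.
    by rewrite enormBC ltW.
  exists p; split.
    by have := ler_enormBD p z; rewrite (enormBC p); lra.
  exists t, s; split => //.
  + by rewrite t0 (lt_le_trans te).
  + by rewrite s0 (lt_le_trans se).
  + exact: lt_le_trans ts r1r.
  + by rewrite qE.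
  + by apply: le_trans zp _; rewrite lerD2l.
have Dp0 : gtan theta K y d p0.
  move=> r /hp0[p [pp0 [t [s [ht hs hts [Kp _] _]]]]].
  by exists t, s, p.
have zp0 : enorm (z - p0) <= sg * enorm mu.
  apply/ler_addgt0Pr => r r0; have r2 : 0 < r / 2 by rewrite divr_gt0.
  have [p [pp0 [t [s [_ _ _ _ zp]]]]] := hp0 _ r2.
  by apply: le_trans (ler_enorm_dist p _ _) _; lra.
(* With [q = p0 - v], the distance bound gives [|q|^2 <= tau <mu, q>], while the proximal inequality
   gives [2 tau <mu, q> <= |q|^2]; so [q = 0]. *)
have p0v : p0 = v.
  have := nearest_point_dotv _ v mu p0 tau hn Dp0.
  have : enorm (z - p0) ^+ 2 <= (sg * enorm mu) ^+ 2.
    by rewrite ler_sqr ?nnegrE // mulr_ge0 // ltW.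
  have -> : z - p0 = sg *: mu - (p0 - v).
    by rewrite /z; vec_ring.
  move=> H1 H2; apply/eqP; rewrite -subr_eq0; apply/eqP; apply: enorm_eq0.
  move: H1 H2; move: (p0 - v) => q.
  rewrite exprMn !sqr_enorm !dotvE (dotvC q mu) -!sqr_enorm => H1 H2.
  have q2 : enorm q ^+ 2 <= 0 by move: H1 H2; rewrite /sg; lra.
  by have := enorm_ge0 q; nra.
pose V := enorm v + 2; have V0 : 0 < V by rewrite ltr_wpDl.
pose r := Num.min 1 (Num.min (e / V) (e * sg)).
have r0 : 0 < r by rewrite !lt_min ltr01 divr_gt0 // mulr_gt0.
have [p [+ [t [s [+ + _ hnp _]]]]] := hp0 r r0; rewrite p0v.
rewrite !lt_min => /and3P[p1 _ pe] /and4P[t0 _ teV _] /and4P[s0 _ seV _].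
have pV : enorm p <= V by have := ler_enormBD p v; rewrite /V; lra.
have V1 : 1 < V by have := enorm_ge0 v; rewrite /V; lra.
(* The second-order term is absorbed into the direction: [t d + (t s / 2) p = t (d + (s / 2) p)]. *)
exists t, (d + (2^-1 * s) *: p), (sg^-1 *: (z - p)); split.
- rewrite t0 /=; apply: lt_le_trans teV _; rewrite ler_pdivrMr //.
  by rewrite ler_peMr // ltW.
- rewrite addrC addKr enormZ gtr0_norm ?mulr_gt0 ?invr_gt0 //.
  move: seV; rewrite ltr_pdivlMr // => seV.
  by have := enorm_ge0 p; nra.
- have -> : sg^-1 *: (z - p) - mu = sg^-1 *: (v - p).
    rewrite /z addrAC scalerDr scalerA mulVf ?gt_eqF // scale1r addrK //.
  rewrite enormZ gtr0_norm ?invr_gt0 // enormBC mulrC ltr_pdivrMr //.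
- apply: prox_frechet; exists (2^-1 * t * s * sg); split.
    by rewrite !mulr_gt0 ?invr_gt0.
  have -> : y + t *: (d + (2^-1 * s) *: p) = pt t s p.
    by rewrite /pt scalerDr scalerA addrA; congr (_ + _ *: _); ring.
  have -> // : pt t s p + (2^-1 * t * s * sg) *: (sg^-1 *: (z - p)) = pt t s z.
  rewrite scalerA -mulrA divff ?gt_eqF // mulr1 /pt -addrA -scalerDr.
  by rewrite [p + _]addrC subrK.
Qed.

(** Otherwise some points [a] of [S] lie within [t rho] of [x + t d'] for arbitrarily small [t] and
    [d'] near [d]. The quotients [(a - x) / t] then cluster at a tangent vector within [rho] of
    [d]. *)
Lemma setdist_tangent_lower {R : realType} {k} (S : set 'cV[R]_k) (x d : 'cV[R]_k) (rho : R) :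
  S x -> 0 <= rho -> rho < setdist d (tangent_cone S x) ->
  exists2 r : R, 0 < r & forall (t : R) (d' : 'cV[R]_k), 0 < t < r ->
    enorm (d' - d) < r -> t * rho <= setdist (x + t *: d') S.
Proof.
move=> Sx rho0 hrho; apply: contrapT => H.
pose P (r : R) (d2 : 'cV[R]_k) := exists (t : R) (d' : 'cV[R]_k),
  [/\ 0 < t < r, enorm (d' - d) < r, S (x + t *: d2) & enorm (d' - d2) <= rho].
have [||d0 [_ hd0]] := @bounded_cluster R k P (enorm d + 1 + rho).
- move=> r r' d2 rr' [t [d' [/andP[t0 tr] dr H1 H2]]]; exists t, d'; split => //.
  + by rewrite t0 (lt_le_trans tr).
  + exact: lt_le_trans dr rr'.
- move=> r r0; apply: contrapT => H'; apply: H.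
  exists (Num.min r 1); first by rewrite lt_min r0 ltr01.
  move=> t d'; rewrite !lt_min => /and3P[t0 tr _] /andP[dr d1].
  rewrite leNgt; apply/negP => /(setdist_lt _ _ _ (ex_intro _ x Sx))[a Sa ad].
  apply: H'; pose d2 := t^-1 *: (a - x).
  have aE : x + t *: d2 = a.
    by rewrite /d2 scalerA divff ?gt_eqF // scale1r addrC subrK.
  have dd2 : enorm (d' - d2) <= rho.
    move: ad; rewrite -aE opprD addrACA subrr add0r -scalerBr enormZ gtr0_norm //.
    by rewrite ltr_pM2l // => /ltW.
  exists d2; split.
    by have := ler_enormBD d2 d'; rewrite (enormBC d2); have := ler_enormBD d' d; lra.
  by exists t, d'; rewrite aE t0.
have Td0 : tangent_cone S x d0.
  by apply/tangent_coneP => r /hd0[d2 [d2d0 [t [d' [ht _ St _]]]]]; exists t, d2.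
have : setdist d (tangent_cone S x) <= rho.
  apply/ler_addgt0Pr => r r0; have r2 : 0 < r / 2 by rewrite divr_gt0.
  have [d2 [d2d0 [t [d' [_ dd' _ dd2]]]]] := hd0 _ r2.
  apply: le_trans (setdist_le d _ _ Td0) _.
  apply: le_trans (ler_enorm_dist d' _ _) _.
  rewrite (enormBC d); have := ler_enorm_dist d2 d' d0; lra.
by rewrite leNgt hrho.
Qed.

(** A proximal normal [v] near [d] has [<v, z> <= 0] for every tangent [z], whence
    [|v| <= |d - z| + |d - v|]. Adding [|d| <= |v| + |d - v|] counts the error [|d - v|] twice,
    which explains [1 - 2 eps]. *)
Lemma prox_normal_eps_dist {R : realType} {k} (S : set 'cV[R]_k) (x d : 'cV[R]_k) (eps : R) :
  prox_normal_eps S x eps d ->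
  (1 - 2 * eps) * enorm d <= setdist d (tangent_cone S x).
Proof.
move=> [Sx hd]; apply: le_setdist; first by exists 0; exact: tangent_cone0.
move=> z Tz; apply/ler_addgt0Pr => e e0.
(* The vector [0] is a proximal normal, so the distance to the cone is a genuine infimum. *)
have pn : prox_normal S x !=set0.
  by exists 0, 1; split => //; rewrite scaler0 addr0; split => // a _; rewrite subrr enorm0.
have [|v [tau [tau0 hn]] dv] := @setdist_lt R k d _ (eps * enorm d + e / 2) pn.
  by apply: le_lt_trans hd _; rewrite ltrDl divr_gt0.
have vz : dotv v z <= 0.
  apply/ler_addgt0Pr => e1 e10; rewrite add0r.
  pose Z := enorm z + 1; have Z0 : 0 < Z by rewrite ltr_wpDl.
  pose W := enorm v + 1; have W0 : 0 < W by rewrite ltr_wpDl.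
  pose r := Num.min 1 (Num.min (e1 / 2 / W) (e1 * tau / Z ^+ 2)).
  have r0 : 0 < r by rewrite !lt_min ltr01 !divr_gt0 ?exprn_gt0 ?mulr_gt0.
  have [t [z' [/andP[t0 +] + Sz]]] := (proj1 (tangent_coneP S x z)) Tz r r0.
  rewrite !lt_min => /and3P[_ _ tZ] /and3P[z1 zW _].
  have := nearest_point_dotv S x v _ tau hn Sz; rewrite addrC addKr dotvZr enormZ gtr0_norm //.
  have z'Z : enorm z' <= Z by have := ler_enormBD z' z; rewrite /Z; lra.
  have -> : dotv v z = dotv v z' + dotv v (z - z') by rewrite -dotvDr addrC subrK.
  have b1 : dotv v (z - z') <= e1 / 2.
    apply: le_trans (dotv_le _ _) _; rewrite enormBC.
    move: zW; rewrite ltr_pdivlMr // /W => zW; have := enorm_ge0 v.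
    have := enorm_ge0 (z' - z); nra.
  move=> H.
  have : 2 * tau * dotv v z' <= t * Z ^+ 2.
    have : 2 * tau * (t * dotv v z') <= t * (t * Z ^+ 2).
      apply: le_trans H _; rewrite exprMn expr2 -mulrA !ler_pM2l // ler_sqr ?nnegrE //.
      exact: ltW.
    by rewrite mulrCA ler_pM2l.
  move: tZ; rewrite ltr_pdivlMr ?exprn_gt0 // => tZ H2.
  have : 2 * tau * dotv v z' <= tau * e1 by lra.
  by nra.
have h1 : dotv v v + dotv (d - v) v <= dotv (d - z) v.
  by rewrite -dotvDl addrC subrK !dotvE (dotvC z); lra.
have h2 : enorm v ^+ 2 <= (enorm (d - z) + enorm (d - v)) * enorm v.
  have := dotv_le (d - z) v; have := normr_dotv_le (d - v) v.
  rewrite ler_norml -sqr_enorm in h1 * => /andP[k1 _]; lra.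
have h3 : enorm v <= enorm (d - z) + enorm (d - v).
  have := enorm_ge0 v; rewrite le_eqVlt => /orP[/eqP <-|v0]; first exact: addr_ge0.
  by rewrite -(ler_pM2r v0) -expr2.
by have := ler_enormBD d v; lra.
Qed.

(** * Multipliers for linear objectives over calm affine systems *)

(** Here [v] ranges over [D]. The weights are written as squares so that completing the square only
    scales by [a] and [b]. *)
Definition penalized {R : realType} {n m} (G : 'M[R]_(m, n)) (h : 'cV[R]_m) (c : 'cV[R]_n)
    (a b : R) (w : 'cV[R]_n) (v : 'cV[R]_m) : R :=
  dotv c w + a ^+ 2 * enorm w ^+ 2 + b ^+ 2 * enorm (G *m w + h - v) ^+ 2.

Lemma sqr_enorm_split {R : realType} {n m} (z : 'cV[R]_(n + m)) :
  enorm z ^+ 2 = enorm (usubmx z) ^+ 2 + enorm (dsubmx z) ^+ 2.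
Proof.
rewrite !sqr_enorm /dotv big_split_ord /=.
by congr (_ + _); apply: eq_bigr => i _; rewrite !mxE.
Qed.

(* Completing the square in [w] turns the joint minimisation into the search for
   a nearest point of a closed set in the product space. *)
Lemma penalized_min {R : realType} {n m} (G : 'M[R]_(m, n)) (h : 'cV[R]_m) (c : 'cV[R]_n)
    (a b : R) (D : set 'cV[R]_m) :
  closed D -> D !=set0 -> 0 < a -> 0 < b ->
  exists w v, D v /\ forall w' v', D v' ->
    penalized G h c a b w v <= penalized G h c a b w' v'.
Proof.
move=> cD [v0 Dv0] a0 b0.
(* [emb] is an affine bijection in the pair of [w] and [v], and [psi] recovers [v]. Up to a
   constant, the objective is the squared distance from [y0] to [emb w v]. *)
pose psi (z : 'cV[R]_(n + m)) : 'cV[R]_m :=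
  G *m (a^-1 *: usubmx z) + h - b^-1 *: dsubmx z.
pose emb (w : 'cV[R]_n) (v : 'cV[R]_m) : 'cV[R]_(n + m) :=
  col_mx (a *: w) (b *: (G *m w + h - v)).
pose y0 : 'cV[R]_(n + m) := col_mx (- (2 * a)^-1 *: c) 0.
have psi_emb w v : psi (emb w v) = v.
  rewrite /psi /emb col_mxKu col_mxKd !scalerA !mulVf ?gt_eqF // !scale1r.
  by rewrite opprB addrC subrK.
have dist_emb w v : enorm (y0 - emb w v) ^+ 2 =
    penalized G h c a b w v + (2 * a) ^- 2 * enorm c ^+ 2.
  rewrite sqr_enorm_split /y0 /emb opp_col_mx add_col_mx col_mxKu col_mxKd.
  rewrite sub0r enormN enormZ exprMn real_normK ?num_real // /penalized.
  move: (b ^+ 2 * _) => Y; rewrite !sqr_enorm !dotvE (dotvC w c).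
  by field; rewrite gt_eqF.
have psiB z z' : psi z' - psi z =
    G *m (a^-1 *: usubmx (z' - z)) - b^-1 *: dsubmx (z' - z).
  rewrite [usubmx (z' - z)]linearB [dsubmx (z' - z)]linearB /= /psi scalerBr mulmxBr.
  by move: (G *m (a^-1 *: usubmx z)) (G *m (a^-1 *: usubmx z')) => u v; vec_ring.
have cZ : closed [set z | D (psi z)].
  apply/closed_enormP => z hz /=; apply: (proj1 (closed_enormP D) cD) => e e0.
  have [M [M0 hM]] := mulmx_bounded G.
  pose L := M * a^-1 + b^-1.
  have L0 : 0 < L by rewrite addr_gt0 ?mulr_gt0 ?invr_gt0.
  have [z' Dz' zz'] := hz (e / L) (divr_gt0 e0 L0).
  exists (psi z') => //; rewrite psiB.
  apply: le_lt_trans (ler_enormB _ _) _.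
  have := sqr_enorm_split (z' - z) => sq.
  have u1 : enorm (usubmx (z' - z)) <= enorm (z' - z).
    by apply: ler_of_sqr => //; rewrite sq lerDl sqr_ge0.
  have d1 : enorm (dsubmx (z' - z)) <= enorm (z' - z).
    by apply: ler_of_sqr => //; rewrite sq lerDr sqr_ge0.
  apply: (@le_lt_trans _ _ (L * enorm (z' - z))); last by rewrite mulrC -ltr_pdivlMr.
  rewrite /L mulrDl; apply: lerD.
    apply: le_trans (hM _) _.
    by rewrite enormZ gtr0_norm ?invr_gt0 // mulrA ler_pM2l ?mulr_gt0 ?invr_gt0.
  by rewrite enormZ gtr0_norm ?invr_gt0 // ler_pM2l ?invr_gt0.
have [|z [Dz hz]] := nearest_point_exists _ y0 cZ.
  by exists (emb 0 v0); rewrite /= psi_emb.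
exists (a^-1 *: usubmx z), (psi z); split=> // w' v' Dv'.
have zE : emb (a^-1 *: usubmx z) (psi z) = z.
  rewrite /emb /psi opprB scalerA divff ?gt_eqF // scale1r.
  rewrite addrC subrK scalerA divff ?gt_eqF // scale1r.
  exact: vsubmxK.
rewrite -(lerD2r ((2 * a) ^- 2 * enorm c ^+ 2)) -!dist_emb zE.
by rewrite ler_sqr ?nnegrE // hz //= psi_emb.
Qed.

(** At [t = - p / (2 Q)] with [Q = |q| + 1], the polynomial is [(p / (2 Q))^2 (q - 2 Q)], negative
    unless [p = 0]. *)
Lemma linear_coef0 {R : realType} (p q : R) :
  (forall t : R, 0 <= t * p + t ^+ 2 * q) -> p = 0.
Proof.
move=> h; pose Q := `|q| + 1; have Q0 : 0 < Q by rewrite ltr_wpDl.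
have qQ : q < Q by rewrite /Q; have := ler_norm q; lra.
have := h (- p / (2 * Q)).
have -> : - p / (2 * Q) * p + (- p / (2 * Q)) ^+ 2 * q =
   (p / (2 * Q)) ^+ 2 * (q - 2 * Q) by field; rewrite gt_eqF.
move=> H; have s0 := sqr_ge0 (p / (2 * Q)).
have : (p / (2 * Q)) ^+ 2 = 0 by nra.
move/eqP; rewrite expf_eq0 /= mulf_eq0 invr_eq0 mulf_eq0 pnatr_eq0 /= (gt_eqF Q0) orbF.
by move/eqP.
Qed.

Lemma penalized_stationary {R : realType} {n m} (G : 'M[R]_(m, n)) (h : 'cV[R]_m)
    (c : 'cV[R]_n) (a b : R) (w : 'cV[R]_n) (v : 'cV[R]_m) :
  (forall w', penalized G h c a b w v <= penalized G h c a b w' v) ->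
  c + (2 * a ^+ 2) *: w + G^T *m ((2 * b ^+ 2) *: (G *m w + h - v)) = 0.
Proof.
move=> hmin; set X := G *m w + h - v; set Y := _ + _ + _.
have YE (u : 'cV[R]_m) z : dotv (c + (2 * a ^+ 2) *: w + G^T *m ((2 * b ^+ 2) *: u)) z =
    dotv c z + 2 * a ^+ 2 * dotv w z + 2 * b ^+ 2 * dotv u (G *m z).
  rewrite !dotvDl -scalemxAr !dotvZl (dotvC (G^T *m u)) -dotv_mulmx.
  by rewrite (dotvC u).
have hY z : dotv Y z = 0.
  apply: (@linear_coef0 R _ (a ^+ 2 * enorm z ^+ 2 + b ^+ 2 * enorm (G *m z) ^+ 2)) => t.
  have := hmin (w + t *: z); rewrite /penalized.
  have -> : G *m (w + t *: z) + h - v = X + t *: (G *m z).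
    by rewrite mulmxDr -scalemxAr /X; move: (G *m w) (G *m z) => *; vec_ring.
  rewrite {1}/Y YE.
  clear Y; rewrite -/X; move: X (G *m z) => {}X Gz.
  rewrite !sqr_enorm !dotvE (dotvC z w) (dotvC Gz X); lra.
by apply: enorm_eq0; rewrite /enorm hY sqrtr0.
Qed.

(** For fixed [a], the penalty weight [b] grows. At a minimiser, [v] is a point of [D] nearest to
    [G w + h], so [2 b^2 (G w + h - v)] is a proximal normal to [D] at [v]. The error bound keeps
    these multipliers bounded, and the pairs of [w] and [lam] cluster at a feasible [w]. *)
Lemma regularized_multiplier {R : realType} {n m} (G : 'M[R]_(m, n)) (h : 'cV[R]_m)
    (c : 'cV[R]_n) (D : set 'cV[R]_m) (P : set 'cV[R]_n) (kap a : R) (p0 : 'cV[R]_n) :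
  closed D -> closed P -> 0 < kap -> 0 < a <= 1 -> P p0 ->
  (forall w, P w -> D (G *m w + h)) ->
  (forall (w : 'cV[R]_n) (v : 'cV[R]_m), D v ->
     exists2 p, P p & enorm (w - p) <= kap * enorm (G *m w + h - v)) ->
  exists w lam, [/\ P w, c + (2 * a ^+ 2) *: w + G^T *m lam = 0,
    (forall e : R, 0 < e -> exists v mu : 'cV[R]_m, [/\ enorm (v - (G *m w + h)) < e,
        enorm (mu - lam) < e & prox_normal D v mu]),
    enorm lam <= 4 * kap * enorm (c + (2 * a ^+ 2) *: w) &
    dotv c w + a ^+ 2 * enorm w ^+ 2 <= dotv c p0 + a ^+ 2 * enorm p0 ^+ 2].
Proof.
move=> cD cP kap0 /andP[a0 a1] Pp0 PD calm.
have a20 : 0 < a ^+ 2 by rewrite exprn_gt0.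
have a2g : 0 <= 2 * a ^+ 2 by lra.
have a21 : a ^+ 2 <= 1 by rewrite expr_le1 // ltW.
pose Phi0 := dotv c p0 + a ^+ 2 * enorm p0 ^+ 2.
(* Any [w] with [<c, w> + a^2 |w|^2 <= Phi0] has norm at most [W]; the summand [1] settles
   [|w| <= 1]. *)
pose W := 1 + (enorm c + `|Phi0|) / a ^+ 2.
have W0 : 0 < W by rewrite ltr_pwDl // divr_ge0 ?addr_ge0 // ltW.
pose L (w : 'cV[R]_n) := enorm (c + (2 * a ^+ 2) *: w).
have L0 w : 0 <= L w by exact: enorm_ge0.
pose LW := enorm c + 2 * W; have LW0 : 0 <= LW by rewrite addr_ge0 // mulr_ge0 // ltW.
have LLW w : enorm w <= W -> L w <= LW.
  move=> wW; apply: le_trans (ler_enormD _ _) _; rewrite lerD2l enormZ.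
  rewrite (ger0_norm a2g) -mulrA ler_pM2l //.
  by have := enorm_ge0 w; nra.
pose Q (e : R) (w : 'cV[R]_n) (lam : 'cV[R]_m) := exists v p,
  [/\ enorm (G *m w + h - v) <= e, P p /\ enorm (w - p) <= e,
      c + (2 * a ^+ 2) *: w + G^T *m lam = 0 /\ enorm w <= W, prox_normal D v lam &
      enorm lam <= 4 * kap * L w /\ dotv c w + a ^+ 2 * enorm w ^+ 2 <= Phi0].
have Qmono (e e' : R) w lam : e <= e' -> Q e w lam -> Q e' w lam.
  move=> ee' [v [p [H1 [H2 H3] H4 H5 H6]]]; exists v, p; split => //.
  - exact: le_trans H1 ee'.
  - by split => //; exact: le_trans H3 ee'.
have Qex (e : R) : 0 < e -> exists w lam, Q e w lam.
  move=> e0.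
  (* The first bound on [b] absorbs the quadratic term of the comparison below; the other two make
     the residual and the distance to [P] at most [e]. *)
  have [b [b0 bk b1 b2]] : exists b : R, [/\ 0 < b, 2 * kap ^+ 2 <= b ^+ 2,
     2 * kap * LW <= b ^+ 2 * e & 2 * kap ^+ 2 * LW <= b ^+ 2 * e].
    pose b := 1 + 2 * kap ^+ 2 + 2 * kap * LW / e + 2 * kap ^+ 2 * LW / e.
    have k2 : 0 < kap ^+ 2 by rewrite exprn_gt0.
    have t1 : 0 <= 2 * kap * LW / e by rewrite divr_ge0 ?mulr_ge0 // ltW.
    have t2 : 0 <= 2 * kap ^+ 2 * LW / e by rewrite divr_ge0 ?mulr_ge0 // ltW.
    have b1 : 1 <= b by rewrite /b; lra.
    have bb : b <= b ^+ 2 by rewrite expr2 ler_peMl //; lra.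
    exists b; split.
    - lra.
    - by apply: le_trans bb; rewrite /b; lra.
    - by rewrite -ler_pdivrMr //; apply: le_trans bb; rewrite /b; lra.
    - by rewrite -ler_pdivrMr //; apply: le_trans bb; rewrite /b; lra.
  have [w [v [Dv hmin]]] := @penalized_min R n m G h c a b D cD (ex_intro _ _ (PD _ Pp0)) a0 b0.
  pose X := G *m w + h - v.
  have [p Pp wp] := calm w v Dv.
  have b20 : 0 < b ^+ 2 by rewrite exprn_gt0.
  have obj : dotv c w + a ^+ 2 * enorm w ^+ 2 <= Phi0.
    have := hmin p0 _ (PD _ Pp0); rewrite /penalized subrr enorm0 expr0n mulr0 addr0.
    by have := sqr_ge0 (enorm (G *m w + h - v)); rewrite /Phi0; nra.
  have wW : enorm w <= W.
    have [w1|w1] := leP (enorm w) 1.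
      by rewrite /W; apply: le_trans w1 _; rewrite lerDl divr_ge0 ?addr_ge0 // ltW.
    have : a ^+ 2 * enorm w ^+ 2 <= (enorm c + `|Phi0|) * enorm w.
      have := normr_dotv_le c w; rewrite ler_norml => /andP[k1 _].
      have := ler_norm Phi0; have := normr_ge0 Phi0; nra.
    rewrite expr2 mulrA ler_pM2r; last by lra.
    rewrite mulrC -ler_pdivlMr // => /le_trans; apply.
    by rewrite /W lerDr.
  (* Compare with the feasible [p] near [w], which has no penalty: [b^2 |X|^2 <= <c + 2 a^2 w, p -
     w> + a^2 |p - w|^2]. By the error bound this is at most [kap L(w) |X| + kap^2 |X|^2], whose
     last term is at most half of the left side. *)
  have key : b ^+ 2 * enorm X <= 2 * kap * L w.
    have [->|X0] := eqVneq (enorm X) 0.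
      by rewrite mulr0 mulr_ge0 ?L0 // mulr_ge0 // ltW.
    have Xp : 0 < enorm X by rewrite lt_neqAle eq_sym X0 enorm_ge0.
    have := hmin p _ (PD _ Pp); rewrite /penalized subrr enorm0 expr0n mulr0 addr0 -/X.
    have := dotv_le (c + (2 * a ^+ 2) *: w) (p - w); rewrite -/(L w).
    rewrite (enormBC p) => H1.
    have : enorm p ^+ 2 = enorm w ^+ 2 + 2 * dotv w (p - w) + enorm (w - p) ^+ 2.
      by rewrite (enormBC w p) !sqr_enorm !dotvE (dotvC p w); ring.
    move=> E; rewrite E; move: H1; rewrite !dotvE => H1 H2.
    have h3 : L w * enorm (w - p) <= L w * (kap * enorm X) by rewrite ler_wpM2l.
    have h4 : enorm (w - p) ^+ 2 <= (kap * enorm X) ^+ 2.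
      by rewrite ler_sqr ?nnegrE // mulr_ge0 // ltW.
    have h5 : a ^+ 2 * enorm (w - p) ^+ 2 <= (kap * enorm X) ^+ 2.
      by apply: le_trans h4; rewrite ler_piMl // sqr_ge0.
    have h6 : 2 * kap ^+ 2 * enorm X ^+ 2 <= b ^+ 2 * enorm X ^+ 2.
      by rewrite ler_wpM2r // sqr_ge0.
    have h7 : b ^+ 2 * enorm X ^+ 2 <= 2 * kap * L w * enorm X.
      rewrite exprMn in h5; rewrite dotvDr dotvNr in E; lra.
    by rewrite -(ler_pM2r Xp); rewrite expr2 mulrA in h7.
  have LwW := LLW w wW.
  have kLW : 2 * kap * L w <= 2 * kap * LW by rewrite ler_pM2l // mulr_gt0.
  have Xe : enorm X <= e.
    by rewrite -(ler_pM2l b20); apply: le_trans key _; exact: le_trans kLW b1.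
  exists w, ((2 * b ^+ 2) *: X), v, p; split => //.
  - split=> //; apply: le_trans wp _; rewrite -(ler_pM2l b20).
    rewrite -/X; apply: le_trans b2; rewrite mulrCA.
    apply: (@le_trans _ _ (kap * (2 * kap * LW))); last by rewrite expr2; lra.
    by rewrite ler_pM2l //; exact: le_trans key kLW.
  - split=> //; apply: penalized_stationary => w'; exact: hmin.
  - exists (2 * b ^+ 2)^-1; split; first by rewrite invr_gt0 mulr_gt0.
    rewrite scalerA mulVf ?gt_eqF ?mulr_gt0 // scale1r.
    have -> : v + X = G *m w + h by rewrite /X addrC subrK.
    split=> // v' Dv'.
    have := hmin w v' Dv'; rewrite /penalized lerD2l ler_pM2l //.
    by rewrite ler_sqr ?nnegrE.
  - by split=> //; rewrite enormZ gtr0_norm ?mulr_gt0 //; lra.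
have [||w0 [_ hw0]] := @bounded_cluster R n (fun e w => exists lam, Q e w lam) W.
- by move=> e e' w ee' [lam /(Qmono e e' _ _ ee') ?]; exists lam.
- move=> e /Qex[w [lam Qw]]; exists w; split; last by exists lam.
  by case: Qw => v [p [_ _ [_ ?]]].
(* The second extraction keeps [w] close to [w0], so both limits come from the same pairs. *)
have [||l0 [_ hl0]] := @bounded_cluster R m (fun e lam => exists w, enorm (w - w0) < e /\ Q e w lam)
   (4 * kap * LW).
- move=> e e' lam ee' [w [ww0 /(Qmono e e' _ _ ee') ?]]; exists w; split => //.
  exact: lt_le_trans ww0 ee'.
- move=> e /hw0[w [ww0 [lam Qw]]]; exists lam; split; last by exists w.
  case: Qw => v [p [_ _ [_ wW] _ [/le_trans + _]]]; apply.
  by rewrite ler_pM2l ?mulr_gt0 // LLW.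
have [M [M0 hM]] := mulmx_bounded G.
have [MT [MT0 hMT]] := mulmx_bounded G^T.
exists w0, l0; split.
- apply: (proj1 (closed_enormP P) cP) => e e0; have e2 : 0 < e / 2 by rewrite divr_gt0.
  have [lam [_ [w [ww0 [v [p [_ [Pp wp] _ _ _]]]]]]] := hl0 _ e2.
  exists p => //; apply: le_lt_trans (ler_enorm_dist w _ _) _.
  by rewrite (enormBC p); lra.
- apply: (@enorm_eq_small R n _ (2 + MT)); first by rewrite addr_gt0.
  move=> e e0.
  have [lam [ll0 [w [ww0 [v [p [_ _ [E _] _ _]]]]]]] := hl0 _ e0.
  have -> : c + (2 * a ^+ 2) *: w0 + G^T *m l0 =
     (2 * a ^+ 2) *: (w0 - w) + G^T *m (l0 - lam).
    rewrite -[LHS]subr0 -E mulmxBr; move: (G^T *m l0) (G^T *m lam) => *; vec_ring.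
  apply: le_trans (ler_enormD _ _) _; rewrite [leRHS]mulrDl lerD //.
    rewrite enormZ (ger0_norm a2g) enormBC -mulrA ler_pM2l //.
    by have := enorm_ge0 (w - w0); nra.
  by apply: le_trans (hMT _) _; rewrite ler_pM2l // enormBC ltW.
- move=> e e0; pose e' := e / (1 + M).
  have M10 : 0 < 1 + M by rewrite addr_gt0.
  have e'0 : 0 < e' by rewrite divr_gt0.
  have e'e : e' * (1 + M) = e by rewrite divfK ?gt_eqF.
  have [lam [ll0 [w [ww0 [v [p [Xv _ _ pn _]]]]]]] := hl0 _ e'0.
  exists v, lam; split => //; last by apply: lt_le_trans ll0 _; nra.
  apply: le_lt_trans (ler_enorm_dist (G *m w + h) _ _) _.
  rewrite (enormBC v) opprD addrACA subrr addr0 -mulmxBr.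
  by have := hM (w - w0); nra.
- apply/ler_addgt0Pr => e e0; pose e' := e / (1 + 8 * kap).
  have k0 : 0 < 1 + 8 * kap by rewrite addr_gt0 // mulr_gt0.
  have e'0 : 0 < e' by rewrite divr_gt0.
  have e'e : e' * (1 + 8 * kap) = e by rewrite divfK ?gt_eqF.
  have [lam [ll0 [w [ww0 [v [p [_ _ _ _ [lb _]]]]]]]] := hl0 _ e'0.
  have : enorm l0 <= enorm lam + e'.
    by apply: le_trans (ler_enormBD _ lam) _; rewrite lerD2l enormBC ltW.
  have : L w <= enorm (c + (2 * a ^+ 2) *: w0) + 2 * e'.
    rewrite /L; apply: le_trans (ler_enormBD _ (c + (2 * a ^+ 2) *: w0)) _; rewrite lerD2l.
    rewrite opprD addrACA subrr add0r -scalerBr enormZ (ger0_norm a2g).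
    rewrite -mulrA ler_pM2l //; have := enorm_ge0 (w - w0); nra.
  move=> H1 H2.
  have : 4 * kap * L w <= 4 * kap * (enorm (c + (2 * a ^+ 2) *: w0) + 2 * e').
    by rewrite ler_pM2l // mulr_gt0.
  lra.
- apply/ler_addgt0Pr => e e0; pose B := enorm c + 2 * W + 1.
  have B0 : 0 < B by rewrite ltr_wpDl // addr_ge0 // mulr_ge0 // ltW.
  pose e' := Num.min 1 (e / B).
  have e'0 : 0 < e' by rewrite lt_min ltr01 divr_gt0.
  have e'1 : e' <= 1 by rewrite ge_min lexx.
  have e'B : e' * B <= e by rewrite -ler_pdivlMr // ge_min lexx orbT.
  have [lam [ll0 [w [ww0 [v [p [_ _ [_ wW] _ [_ ob]]]]]]]] := hl0 _ e'0.
  have d1 : dotv c w0 <= dotv c w + enorm c * e'.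
    have -> : dotv c w0 = dotv c w + dotv c (w0 - w) by rewrite -dotvDr addrC subrK.
    rewrite lerD2l; apply: le_trans (dotv_le _ _) _; rewrite enormBC ler_wpM2l //.
    exact: ltW.
  have n1 : enorm w0 <= enorm w + e'.
    by apply: le_trans (ler_enormBD _ w) _; rewrite lerD2l enormBC ltW.
  have w00 := enorm_ge0 w0; have w_0 := enorm_ge0 w.
  have n2 : enorm w0 ^+ 2 <= enorm w ^+ 2 + (2 * W + 1) * e' by nra.
  have n3 : a ^+ 2 * enorm w0 ^+ 2 <= a ^+ 2 * enorm w ^+ 2 + (2 * W + 1) * e'.
    have : 0 <= (2 * W + 1) * e' by rewrite mulr_ge0 ?(ltW e'0) //; lra.
    nra.
  rewrite -/Phi0; rewrite /B in e'B; lra.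
Qed.

(** Now [a] tends to [0]. The lower bound [q] keeps [a |w|] bounded, so the term [2 a^2 w] vanishes
    and the multipliers stay bounded although [w] may escape. Only [lam] has a limit; [w] is kept at
    each tolerance. *)
Lemma calm_multiplier {R : realType} {n m} (G : 'M[R]_(m, n)) (h : 'cV[R]_m)
    (c : 'cV[R]_n) (D : set 'cV[R]_m) (P : set 'cV[R]_n) (kap q : R) :
  closed D -> closed P -> 0 < kap -> D !=set0 ->
  (forall w, P w -> D (G *m w + h)) ->
  (forall (w : 'cV[R]_n) (v : 'cV[R]_m), D v ->
     exists2 p, P p & enorm (w - p) <= kap * enorm (G *m w + h - v)) ->
  (forall w, P w -> q <= dotv c w) ->
  exists lam, c + G^T *m lam = 0 /\
    forall e : R, 0 < e -> exists (lam' : 'cV[R]_m) (w : 'cV[R]_n), [/\ enorm (lam' - lam) < e, P w,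
      limiting_normal D (G *m w + h) lam',
      dotv lam' (G *m w + h) <= dotv lam' h - q &
      forall e' : R, 0 < e' -> exists v mu : 'cV[R]_m,
        enorm (mu - lam') < e' /\ prox_normal D v mu].
Proof.
move=> cD cP kap0 [v0 Dv0] PD calm hq.
have [p0 Pp0 _] := calm 0 v0 Dv0.
(* Comparing the regularised objective at [w] and [p0] gives [(a |w|)^2 <= C1], hence
   [a |w| <= C1 + 1]. *)
pose C1 := dotv c p0 + enorm p0 ^+ 2 - q.
have C10 : 0 <= C1 by have := hq p0 Pp0; have := sqr_ge0 (enorm p0); rewrite /C1; lra.
pose Q (e : R) (lam : 'cV[R]_m) := exists w, [/\ P w,
  enorm (c + G^T *m lam) <= 2 * e * (C1 + 1), limiting_normal D (G *m w + h) lam,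
  dotv lam (G *m w + h) <= dotv lam h - q &
  forall e' : R, 0 < e' -> exists v mu : 'cV[R]_m, enorm (mu - lam) < e' /\ prox_normal D v mu].
have [||lam [_ hlam]] := @bounded_cluster R m Q (4 * kap * (enorm c + 2 * (C1 + 1))).
- move=> e e' lam ee' [w [H1 H2 H3 H4 H5]]; exists w; split => //.
  by apply: le_trans H2 _; rewrite ler_pM2r ?ler_pM2l //; lra.
- move=> e e0; pose a := Num.min 1 e.
  have a0 : 0 < a by rewrite lt_min ltr01.
  have a1 : a <= 1 by rewrite ge_min lexx.
  have ae : a <= e by rewrite ge_min lexx orbT.
  have [|w [lam [Pw E pn lb ob]]] :=
    @regularized_multiplier R n m G h c D P kap a p0 cD cP kap0 _ Pp0 PD calm.
    by rewrite a0.
  have aw2 : (a * enorm w) ^+ 2 <= C1.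
    have := hq w Pw; rewrite exprMn /C1.
    have : a ^+ 2 * enorm p0 ^+ 2 <= enorm p0 ^+ 2.
      by rewrite ler_piMl ?sqr_ge0 // expr_le1 // ltW.
    lra.
  have aw : a * enorm w <= C1 + 1 by nra.
  have eE : enorm ((2 * a ^+ 2) *: w) <= 2 * a * (C1 + 1).
    have a2g : 0 <= 2 * a ^+ 2 by have := sqr_ge0 a; lra.
    rewrite enormZ (ger0_norm a2g).
    by rewrite expr2 !mulrA -[2 * a * a * _]mulrA ler_pM2l // mulr_gt0.
  exists lam; split.
    apply: le_trans lb _; rewrite ler_pM2l ?mulr_gt0 //.
    apply: le_trans (ler_enormD _ _) _; rewrite lerD2l; apply: le_trans eE _.
    by rewrite -mulrA ler_pM2l // ler_piMl //; lra.
  exists w; split => //.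
  + have -> : c + G^T *m lam = - ((2 * a ^+ 2) *: w).
      rewrite -[LHS]subr0 -E; move: (G^T *m lam) => *; vec_ring.
    rewrite enormN; apply: le_trans eE _; rewrite ler_pM2r ?ler_pM2l //; lra.
  + apply: limiting_normal_approx => e1 /pn[v [mu [H1 H2 H3]]].
    by exists v, mu; split => //; exact: prox_frechet.
  + rewrite dotvDr dotvC dotv_mulmx.
    have -> : G^T *m lam = - (c + (2 * a ^+ 2) *: w).
      by rewrite -[LHS]subr0 -E; move: (G^T *m lam) => *; vec_ring.
    rewrite !dotvE (dotvC w c); have := dotvv_ge0 w; have := hq w Pw.
    have : 0 <= a ^+ 2 by exact: sqr_ge0.
    nra.
  + by move=> e1 /pn[v [mu [_ H2 H3]]]; exists v, mu.
exists lam; split.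
  have [M [M0 hM]] := mulmx_bounded G^T.
  apply: (@enorm_eq_small R n _ (2 * (C1 + 1) + M)); first by lra.
  move=> e e0; have [l' [ll [w [_ H _ _ _]]]] := hlam e e0.
  have -> : c + G^T *m lam = (c + G^T *m l') - G^T *m (l' - lam).
    by rewrite mulmxBr; move: (G^T *m lam) (G^T *m l') => *; vec_ring.
  apply: le_trans (ler_enormB _ _) _; rewrite mulrDl lerD //; first by lra.
  by apply: le_trans (hM _) _; rewrite ler_pM2l // ltW.
by move=> e /hlam[l' [ll [w [H1 H2 H3 H4 H5]]]]; exists l', w.
Qed.

(** * Second-order conditions at a solution *)

Lemma half_ts_gt0 {R : realType} (t s : R) : 0 < t -> 0 < s -> 0 < 2^-1 * t * s.
Proof. by move=> t0 s0; rewrite !mulr_gt0 ?invr_gt0. Qed.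

(** The increment of [g] along the curve, less its first-order part and divided by [t s / 2], is a
    vector [u] for which the point lies in [K] exactly; the expansion puts [u] near the affine
    image. *)
Lemma gtan_feasible_image {R : realType} {n m} (g : 'cV[R]_n -> 'cV[R]_m)
    (K : set 'cV[R]_m) (x d w : 'cV[R]_n) (theta : R) :
  C2map g -> 0 <= theta -> gtan theta (feasible g K) x d w ->
  gtan theta K (g x) (jac g x *m d) (jac g x *m w + theta *: hess2 g x d).
Proof.
move=> cg th0 hw e e0; set G := jac g x; set h := hess2 g x d.
have [M [M0 hM]] := mulmx_bounded G.
have e8 : 0 < e / 8 by lra.
have C0 : 0 <= enorm w + 1 by rewrite addr_ge0.
have [r r0 hr] := @path_expansion_map R n m g x d theta (enorm w + 1) (e / 8) cg th0 C0 e8.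
pose e1 := Num.min (Num.min r e) (Num.min 1 (e / (4 * M))).
have e10 : 0 < e1 by rewrite !lt_min r0 e0 ltr01 divr_gt0 // mulr_gt0.
have [t [s [w' [/andP[t0 +] /andP[s0 +] + + Kw]]]] := hw e1 e10.
rewrite !lt_min => /andP[/andP[tr te] _] /andP[/andP[sr se] _] /andP[/andP[tsr tse] _].
move=> /andP[_ /andP[w1 wM]].
have ts0 := half_ts_gt0 t s t0 s0.
pose a := 2^-1 * t * s.
pose u := a^-1 *: (g (x + t *: d + a *: w') - (g x + t *: (G *m d))).
have uE : g x + t *: (G *m d) + a *: u = g (x + t *: d + a *: w').
  by rewrite /u scalerA divff ?gt_eqF // scale1r addrC subrK.
exists t, s, u; split; rewrite ?t0 ?s0 //.
  have w'C : enorm w' <= enorm w + 1 by have := ler_enormBD w' w; lra.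
  have ht : 0 < t < r by rewrite t0.
  have hs : 0 < s < r by rewrite s0.
  have := hr t s w' ht hs tsr w'C; rewrite -/G -/h -/a -uE.
  rewrite opprD addrACA subrr add0r -scalerBr enormZ gtr0_norm // => H.
  have b1 : enorm (u - (G *m w' + theta *: h)) <= e / 4.
    rewrite -(ler_pM2l ts0); apply: le_trans H _; rewrite /a; lra.
  apply: le_lt_trans (ler_enorm_dist (G *m w' + theta *: h) _ _) _.
  rewrite [X in _ + enorm X](_ : _ = G *m (w' - w)); last first.
    by rewrite mulmxBr opprD addrACA subrr addr0.
  have := hM (w' - w); move: wM; rewrite ltr_pdivlMr ?mulr_gt0 //; lra.
by rewrite uE.
Qed.

(** The error bound is applied at [x + t d + (t s / 2) w], whose image is within
    [(t s / 2) (N + o(1))] of [K]. Dividing the displacement to a nearby feasible point by [t s / 2]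
    gives bounded vectors that cluster at [p]. *)
Lemma gtan_calm {R : realType} {n m} (g : 'cV[R]_n -> 'cV[R]_m)
    (K : set 'cV[R]_m) (x d w : 'cV[R]_n) (v : 'cV[R]_m) (theta r0 kap : R) :
  C2map g -> 0 <= theta -> feasible g K x -> 0 < r0 -> 0 < kap ->
  (forall y : 'cV[R]_n, enorm (y - x) < r0 ->
     setdist y (feasible g K) <= kap * setdist (g y) K) ->
  gtan theta K (g x) (jac g x *m d) v ->
  exists2 p, gtan theta (feasible g K) x d p &
    enorm (w - p) <= kap * enorm (jac g x *m w + theta *: hess2 g x d - v).
Proof.
move=> cg th0 Fx r00 kap0 sub hv; set G := jac g x; set h := hess2 g x d.
pose N := enorm (G *m w + theta *: h - v).
pose P (e : R) (p : 'cV[R]_n) := exists t s : R, [/\ 0 < t < e, 0 < s < e,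
  `|t / s - theta| < e, feasible g K (x + t *: d + (2^-1 * t * s) *: p) &
  enorm (w - p) <= kap * N + e].
have [||p [_ hp]] := @bounded_cluster R n P (enorm w + (kap * N + 1)).
- move=> e e' p ee' [t [s [/andP[t0 te] /andP[s0 se] ts Fp wp]]]; exists t, s; split => //.
  + by rewrite t0 (lt_le_trans te).
  + by rewrite s0 (lt_le_trans se).
  + exact: lt_le_trans ts ee'.
  + by apply: le_trans wp _; rewrite lerD2l.
- move=> e e0.
  have [e' [e'0 e'e e'1]] : exists e' : R, [/\ 0 < e', e' <= e & e' <= 1].
    by exists (Num.min e 1); rewrite lt_min e0 ltr01 !ge_min !lexx orbT.
  (* One [e1] comes from [v'] and two from the expansion, all multiplied by [kap]; the [1] leaves a
     strict margin. *)
  pose e1 := e' / (3 * kap + 1).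
  have k1 : 0 < 3 * kap + 1 by rewrite addr_gt0 // mulr_gt0.
  have e10 : 0 < e1 by rewrite divr_gt0.
  have e1E : e1 * (3 * kap + 1) = e' by rewrite divfK ?gt_eqF.
  have [r rp hr] := @path_expansion_map R n m g x d theta (enorm w) e1 cg th0 (enorm_ge0 w) e10.
  pose B := enorm d + enorm w + 1; have B0 : 0 < B by rewrite ltr_wpDl // addr_ge0.
  pose e2 := Num.min (Num.min r e1) (Num.min e' (r0 / B)).
  have e20 : 0 < e2 by rewrite !lt_min rp e10 e'0 divr_gt0.
  have [t [s [v' [/andP[t0 +] /andP[s0 +] + + Kv']]]] := hv e2 e20.
  rewrite !lt_min => /andP[/andP[tr _] /andP[te trB]] /andP[/andP[sr _] /andP[se _]].
  move=> /andP[/andP[tsr _] /andP[tse _]] /andP[/andP[_ v1] _].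
  have ts0 := half_ts_gt0 t s t0 s0.
  pose a := 2^-1 * t * s; pose y := x + t *: d + a *: w.
  have yx : enorm (y - x) < r0.
    rewrite /y -[x + _ + _]addrA [x + _]addrC addrK; apply: le_lt_trans (ler_enormD _ _) _.
    rewrite !enormZ (gtr0_norm t0) (gtr0_norm ts0).
    move: trB; rewrite ltr_pdivlMr // => trB; apply: le_lt_trans trB.
    rewrite /B /a; have := enorm_ge0 d; have := enorm_ge0 w.
    have s1 : s < 1 by lra.
    have ts1 : t * s <= t by rewrite ler_piMr // ltW.
    nra.
  have ht : 0 < t < r by rewrite t0.
  have hs : 0 < s < r by rewrite s0.
  have := hr t s w ht hs tsr (lexx _); rewrite -/G -/h -/a -/y => H.
  have dK : setdist (g y) K <= a * (N + e1 + 2 * e1).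
    apply: le_trans (setdist_le (g y) K _ Kv') _; rewrite -/G -/a.
    apply: le_trans (ler_enorm_dist (g x + t *: (G *m d) + a *: (G *m w + theta *: h)) _ _) _.
    rewrite [X in _ + enorm X](_ : _ = a *: (G *m w + theta *: h - v')); last first.
      by rewrite opprD addrACA subrr add0r -scalerBr.
    rewrite enormZ (gtr0_norm ts0).
    have : enorm (G *m w + theta *: h - v') <= N + e1.
      apply: le_trans (ler_enorm_dist v _ _) _; rewrite lerD2l enormBC ltW //.
    rewrite -(ler_pM2l ts0) => H'.
    have E : e1 * (t * s) = a * (2 * e1) by rewrite /a; field.
    by rewrite E in H; rewrite mulrDr [leLHS]addrC; exact: lerD.
  have [|q Fq yq] := @setdist_lt R n y (feasible g K) (a * (kap * N + e')) (ex_intro _ x Fx).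
    apply: le_lt_trans (sub y yx) _.
    apply: (@le_lt_trans _ _ (kap * (a * (N + e1 + 2 * e1)))); first by rewrite ler_pM2l.
    by rewrite mulrCA ltr_pM2l // -e1E; lra.
  pose p := a^-1 *: (q - (x + t *: d)).
  have qE : x + t *: d + a *: p = q.
    by rewrite /p scalerA divff ?gt_eqF // scale1r addrC subrK.
  have wp : enorm (w - p) <= kap * N + e'.
    move: yq; rewrite -qE /y opprD addrACA subrr add0r -scalerBr enormZ (gtr0_norm ts0).
    by rewrite ltr_pM2l // => /ltW.
  exists p; split.
    by have := ler_enormBD p w; rewrite (enormBC p); lra.
  exists t, s; split.
  + by rewrite t0 (lt_le_trans te).
  + by rewrite s0 (lt_le_trans se).
  + exact: lt_le_trans tse e'e.
  + by rewrite -/a qE.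
  + by apply: le_trans wp _; rewrite lerD2l.
exists p.
  by move=> e /hp[p' [pp' [t [s [H1 H2 H3 H4 _]]]]]; exists t, s, p'.
apply/ler_addgt0Pr => e e0; have e2 : 0 < e / 2 by lra.
have [p' [pp' [t [s [_ _ _ _ wp']]]]] := hp _ e2.
by apply: le_trans (ler_enorm_dist p' _ _) _; rewrite -/N; lra.
Qed.

(** Along the feasible curve, [f] grows by at least [kappa t^2 rho^2], and by expansion, with
    [<grad f, d> <= 0], by at most [t s / 2] times the right-hand side up to a small error. Division
    by [t s / 2] and [t / s -> theta] give the claim. *)
Lemma gtan_objective_aux {R : realType} {n} (f : 'cV[R]_n -> R) (F S : set 'cV[R]_n)
    (x d w : 'cV[R]_n) (theta kappa r0 r1 rho : R) :
  C2fun f -> 0 <= theta -> 0 < kappa -> 0 < r0 -> 0 < r1 -> 0 <= rho ->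
  dotv (grad f x) d <= 0 ->
  (forall y : 'cV[R]_n, F y -> enorm (y - x) < r0 -> f x + kappa * setdist y S ^+ 2 <= f y) ->
  (forall (t : R) (d' : 'cV[R]_n), 0 < t < r1 ->
    enorm (d' - d) < r1 -> t * rho <= setdist (x + t *: d') S) ->
  gtan theta F x d w ->
  2 * kappa * theta * rho ^+ 2 <= dotv (grad f x) w + theta * qform (hess f x) d.
Proof.
move=> cf th0 k0 r00 r10 rho0 fd grow low hw.
apply/ler_addgt0Pr => e e0.
pose c := grad f x; pose q := qform (hess f x) d.
have C0 : 0 <= enorm w + 1 by rewrite addr_ge0.
have e8 : 0 < e / 8 by lra.
have [r rp hr] := @path_expansion R n f x d theta (enorm w + 1) (e / 8) cf th0 C0 e8.
pose Q := 4 * (enorm c + 2 * kappa * rho ^+ 2 + 1).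
have k2 : 0 <= 2 * kappa * rho ^+ 2 by rewrite mulr_ge0 ?sqr_ge0 // mulr_ge0 // ltW.
have Q0 : 0 < Q by rewrite mulr_gt0 // ltr_wpDl // addr_ge0.
pose B := enorm d + (enorm w + 1) + 1; have B0 : 0 < B by rewrite ltr_wpDl // addr_ge0.
pose e1 := Num.min (Num.min r 1) (Num.min (e / Q) (Num.min (r0 / B) (r1 / B))).
have e10 : 0 < e1 by rewrite !lt_min rp ltr01 !divr_gt0.
have [t [s [w' [/andP[t0 +] /andP[s0 +] + + Fw]]]] := hw e1 e10.
rewrite !lt_min => /andP[/andP[tr t1] /and3P[_ trB tr1]] /andP[/andP[sr s1] /and3P[_ _ srB]].
move=> /andP[/andP[tsr _] /and3P[tsQ _ _]] /andP[/andP[_ w1] /and3P[wQ _ _]].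
move: trB tr1 srB tsQ wQ; rewrite !ltr_pdivlMr // => trB tr1 srB tsQ wQ.
have w'C : enorm w' <= enorm w + 1 by have := ler_enormBD w' w; lra.
have d0 := enorm_ge0 d; have w0 := enorm_ge0 w; have w'0 := enorm_ge0 w'.
have ts0 := half_ts_gt0 t s t0 s0.
pose y := x + t *: d + (2^-1 * t * s) *: w'.
have yE : y = x + t *: (d + (2^-1 * s) *: w').
  by rewrite /y scalerDr scalerA -addrA; congr (_ + (_ + _ *: _)); ring.
have yx : enorm (y - x) < r0.
  rewrite yE addrC addKr enormZ (gtr0_norm t0).
  have : enorm (d + (2^-1 * s) *: w') <= B.
    apply: le_trans (ler_enormD _ _) _; rewrite enormZ gtr0_norm ?mulr_gt0 ?invr_gt0 //.
    by rewrite /B; nra.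
  by nra.
have dd : enorm (d + (2^-1 * s) *: w' - d) < r1.
  rewrite addrC addKr enormZ gtr0_norm ?mulr_gt0 ?invr_gt0 //.
  by rewrite /B in srB; nra.
have tr1' : 0 < t < r1 by rewrite t0; rewrite /B in tr1; nra.
have lo := low t _ tr1' dd; rewrite -yE in lo.
have gr := grow y Fw yx.
have ht : 0 < t < r by rewrite t0.
have hs : 0 < s < r by rewrite s0.
have := hr t s w' ht hs tsr w'C; rewrite -/y -/c -/q ler_norml => /andP[_ ex].
have sq : (t * rho) ^+ 2 <= setdist y S ^+ 2.
  have tr0 : 0 <= t * rho by rewrite mulr_ge0 // ltW.
  by rewrite ler_sqr ?nnegrE // (le_trans tr0).
have key : kappa * (t * rho) ^+ 2 <= 2^-1 * t * s * (dotv c w' + theta * q) + e / 8 * (t * s).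
  have : t * dotv c d <= 0 by rewrite pmulr_rle0.
  have : kappa * (t * rho) ^+ 2 <= kappa * setdist y S ^+ 2 by rewrite ler_pM2l.
  move: gr ex; lra.
have key2 : 2 * kappa * (t / s) * rho ^+ 2 <= dotv c w' + theta * q + e / 4.
  rewrite -(ler_pM2l ts0).
  have -> : 2^-1 * t * s * (2 * kappa * (t / s) * rho ^+ 2) = kappa * (t * rho) ^+ 2.
    by field; rewrite gt_eqF.
  apply: le_trans key _; lra.
have b1 : dotv c w' <= dotv c w + e / 4.
  have -> : dotv c w' = dotv c w + dotv c (w' - w) by rewrite -dotvDr addrC subrK.
  rewrite lerD2l; apply: le_trans (dotv_le _ _) _.
  have := enorm_ge0 c; have := enorm_ge0 (w' - w); rewrite /Q in wQ; nra.
have b2 : 2 * kappa * rho ^+ 2 * theta <= 2 * kappa * rho ^+ 2 * (t / s) + e / 4.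
  have := ler_norm (theta - t / s); rewrite distrC; move: tsQ; rewrite /Q.
  move: (`|t / s - theta|) (normr_ge0 (t / s - theta)) => z z0 zQ tz.
  by have := enorm_ge0 c; nra.
rewrite -/c -/q; lra.
Qed.

(** The linear lower bound on the distance to [S] is available for each [rho] strictly below the
    distance to the tangent cone; [rho] is raised to it, the case of distance zero being treated
    with [rho = 0]. *)
Lemma gtan_objective {R : realType} {n} (f : 'cV[R]_n -> R) (F S : set 'cV[R]_n)
    (x d w : 'cV[R]_n) (theta kappa r0 : R) :
  C2fun f -> 0 <= theta -> 0 < kappa -> 0 < r0 -> S x ->
  dotv (grad f x) d <= 0 ->
  (forall y : 'cV[R]_n, F y -> enorm (y - x) < r0 -> f x + kappa * setdist y S ^+ 2 <= f y) ->
  gtan theta F x d w ->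
  2 * kappa * theta * setdist d (tangent_cone S x) ^+ 2
    <= dotv (grad f x) w + theta * qform (hess f x) d.
Proof.
move=> cf th0 k0 r00 Sx fd grow hw; set rho0 := setdist d _.
have rho00 : 0 <= rho0 by apply: setdist_ge0; exists 0; exact: tangent_cone0.
have [E|rho0n] := eqVneq rho0 0.
  rewrite E; apply: (gtan_objective_aux f F S x d w theta kappa r0 1 0) => //.
  by move=> t d' _ _; rewrite mulr0 setdist_ge0 //; exists x.
have rhop : 0 < rho0 by rewrite lt_neqAle eq_sym rho0n.
apply/ler_addgt0Pr => e e0.
pose Q := 4 * kappa * theta * rho0 + 1.
have Q0 : 0 < Q by rewrite ltr_wpDl // !mulr_ge0 // ltW.
(* Replacing [rho0] by [rho0 - del] costs at most [4 kappa theta rho0 del <= e]. *)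
pose del := Num.min (rho0 / 2) (e / Q).
have del0 : 0 < del by rewrite lt_min !divr_gt0.
have del1 : del <= rho0 / 2 by rewrite ge_min lexx.
have delQ : del * Q <= e by rewrite -ler_pdivlMr // ge_min lexx orbT.
have rr : 0 <= rho0 - del by lra.
have rl : rho0 - del < rho0 by lra.
have [r1 r10 low] := setdist_tangent_lower S x d (rho0 - del) Sx rr rl.
have := gtan_objective_aux f F S x d w theta kappa r0 r1 _ cf th0 k0 r00 r10 rr fd grow low hw.
move=> H; rewrite /Q in delQ.
have kt : 0 <= kappa * theta by rewrite mulr_ge0 // ltW.
have : 0 <= kappa * theta * del ^+ 2 by rewrite mulr_ge0 ?sqr_ge0.
lra.
Qed.

(** The linear program has cost [grad f], shift [theta h] and lower bound [q]. The slack [e] arises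
    because the linear estimate contains [<lam', h>] while the bound is stated with [<lam, h>]. *)
Lemma gtan_multiplier {R : realType} {n m} (f : 'cV[R]_n -> R)
    (g : 'cV[R]_n -> 'cV[R]_m) (K : set 'cV[R]_m) (x d : 'cV[R]_n)
    (theta kappa kap r0 : R) :
  C2fun f -> C2map g -> closed K -> 0 <= theta -> 0 < kappa -> 0 < kap -> 0 < r0 ->
  solset f g K x -> dotv (grad f x) d <= 0 ->
  (forall y : 'cV[R]_n, feasible g K y -> enorm (y - x) < r0 ->
     f x + kappa * setdist y (solset f g K) ^+ 2 <= f y) ->
  (forall y : 'cV[R]_n, enorm (y - x) < r0 ->
     setdist y (feasible g K) <= kap * setdist (g y) K) ->
  gtan theta K (g x) (jac g x *m d) !=set0 ->
  exists lam, dir_multipliers f g K x d lam /\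
    forall e : R, 0 < e -> exists (lam' : 'cV[R]_m) (w : 'cV[R]_n),
    [/\ enorm (lam' - lam) < e, gtan theta (feasible g K) x d w,
      limiting_normal (gtan theta K (g x) (jac g x *m d))
        (jac g x *m w + theta *: hess2 g x d) lam' &
      dotv lam' (jac g x *m w + theta *: hess2 g x d) <=
      theta * (dotv lam (hess2 g x d) + qform (hess f x) d
        - 2 * kappa * setdist d (tangent_cone (solset f g K) x) ^+ 2) + e].
Proof.
move=> cf cg cK th0 k0 kap0 r00 Sx fd grow sub Dn.
set G := jac g x; set h := hess2 g x d; set D := gtan theta K _ _.
pose F := feasible g K; pose P := gtan theta F x d.
pose q := theta * (2 * kappa * setdist d (tangent_cone (solset f g K) x) ^+ 2
   - qform (hess f x) d).
have [||w Pw|w v Dv|w Pw|lam [E hl]] :=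
  @calm_multiplier R n m G (theta *: h) (grad f x) D P kap q _ _ kap0 Dn.
- exact: gtan_closed.
- exact: gtan_closed.
- exact: gtan_feasible_image.
- by apply: (gtan_calm g K x d w v theta r0 kap) => //; case: Sx.
- have := gtan_objective f F (solset f g K) x d w theta kappa r0 cf th0 k0 r00 Sx fd grow Pw.
  by rewrite /q; lra.
exists lam; split.
  split; first by rewrite grad_lagr.
  apply: dir_normal_approx => e e0; have e3 : 0 < e / 3 by lra.
  have [l1 [w [l1l _ _ _ hp]]] := hl _ e3.
  have [v [mu [mul pn]]] := hp _ e3.
  have [t [d' [mu' [ht hd hmu fr]]]] := gtan_prox_dir theta K (g x) (G *m d) v mu (e / 3) cK pn e3.
  have /andP[t0 te] := ht.
  exists t, d', mu'; split => //.
  - by rewrite t0; lra.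
  - by apply: lt_trans hd _; lra.
  - apply: le_lt_trans (ler_enorm_dist mu _ _) _.
    by have := ler_enorm_dist l1 mu lam; lra.
move=> e e0; pose Q := theta * enorm h + 1.
have Q0 : 0 < Q by rewrite ltr_wpDl // mulr_ge0.
pose e1 := e / Q; have e10 : 0 < e1 by rewrite divr_gt0.
have e1E : e1 * Q = e by rewrite divfK ?gt_eqF.
have [l1 [w [l1l Pw ln le hp]]] := hl _ e10.
exists l1, w; split => //.
  by apply: lt_le_trans l1l _; rewrite -e1E ler_peMr ?(ltW e10) // /Q lerDr mulr_ge0.
apply: le_trans le _; rewrite /q dotvZr.
have b : dotv l1 h <= dotv lam h + e1 * enorm h.
  have -> : dotv l1 h = dotv lam h + dotv (l1 - lam) h by rewrite -dotvDl addrC subrK.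
  rewrite lerD2l; apply: le_trans (dotv_le _ _) _; rewrite ler_wpM2r //; exact: ltW.
have : theta * dotv l1 h <= theta * (dotv lam h + e1 * enorm h) by rewrite ler_wpM2l.
by rewrite /Q in e1E; lra.
Qed.

(** * Lower generalized support functions and conclusion *)

Lemma lsupp_le {R : realType} {k} (D A : set 'cV[R]_k) (lam : 'cV[R]_k) (b : R) :
  D !=set0 ->
  (forall e : R, 0 < e -> exists lam' u : 'cV[R]_k, [/\ enorm (lam' - lam) < e, A u,
     limiting_normal D u lam' & dotv lam' u <= b + e]) ->
  (lsupp D A lam <= b%:E)%E.
Proof.
move=> [v0 Dv0] h; rewrite /lsupp; case: pselect => [D0|nD0] /=.
  by rewrite D0 in Dv0.
apply: ge_ereal_sup => _ [r r0 <-]; apply/lee_addgt0Pr => e e0.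
(* One tolerance serves both as radius of the ball around [lam] and as slack in the value. *)
have [|l' [u [ll Au nu le]]] := h (Num.min r e); first by rewrite lt_min r0.
move: ll; rewrite lt_min => /andP[lr _].
apply: (@le_trans _ _ (dotv l' u)%:E); last first.
  by rewrite -EFinD lee_fin (le_trans le) // lerD2l ge_min lexx orbT.
apply: (@le_trans _ _ (lsupp_inner D A l')).
  by apply: ereal_inf_lbound; exists l'.
by apply: ereal_inf_lbound; exists u.
Qed.

(** A free real [b] below the distance bound lets both right-hand sides of the theorem be read off
    from one statement. *)
Lemma second_order_conditions {R : realType} {n m} (f : 'cV[R]_n -> R)
    (g : 'cV[R]_n -> 'cV[R]_m) (K : set 'cV[R]_m) (x d : 'cV[R]_n) (kappa kap r0 : R) :
  C2fun f -> C2map g -> closed K -> 0 < kappa -> 0 < kap -> 0 < r0 ->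
  solset f g K x -> crit_cone f g K x d ->
  (forall y : 'cV[R]_n, feasible g K y -> enorm (y - x) < r0 ->
     f x + kappa * setdist y (solset f g K) ^+ 2 <= f y) ->
  (forall y : 'cV[R]_n, enorm (y - x) < r0 ->
     setdist y (feasible g K) <= kap * setdist (g y) K) ->
  (exists lam, dir_multipliers f g K x d lam /\
     forall A, Theta g K x d `<=` A ->
       (lsupp (tangentpp K (g x) (jac g x *m d)) A lam <= 0)%E) /\
  (tangent2 K (g x) (jac g x *m d) !=set0 ->
   exists lam, dir_multipliers f g K x d lam /\
     forall (b : R) B, Omega g K x d `<=` B ->
       b <= 2 * kappa * setdist d (tangent_cone (solset f g K) x) ^+ 2 ->
       (b%:E <= (qform (hess (fun y => lagr f g y lam) x) d)%:E
          - lsupp (tangent2 K (g x) (jac g x *m d)) B lam)%E).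
Proof.
move=> cf cg cK k0 kap0 r00 Sx [Td fd] grow sub.
have mult theta (th0 : 0 <= theta) := gtan_multiplier f g K x d theta kappa kap r0
  cf cg cK th0 k0 kap0 r00 Sx fd grow sub.
have second : tangent2 K (g x) (jac g x *m d) !=set0 ->
   exists lam, dir_multipliers f g K x d lam /\
     forall (b : R) B, Omega g K x d `<=` B ->
       b <= 2 * kappa * setdist d (tangent_cone (solset f g K) x) ^+ 2 ->
       (b%:E <= (qform (hess (fun y => lagr f g y lam) x) d)%:E
          - lsupp (tangent2 K (g x) (jac g x *m d)) B lam)%E.
  rewrite tangent2_gtan => T2; have [lam [dl hl]] := mult 1 ler01 T2.
  exists lam; split => // b B OB bk; rewrite qform_hess_lagr //.
  set a := qform (hess f x) d + _.
  have : (lsupp (gtan 1 K (g x) (jac g x *m d)) B lam <= (a - b)%:E)%E.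
    apply: lsupp_le => // e /hl[l' [w [ll Pw ln le]]].
    exists l', (jac g x *m w + 1 *: hess2 g x d); split => //.
      by apply: OB; exists w; rewrite ?tangent2_gtan ?scale1r.
    by apply: le_trans le _; rewrite lerD2r /a; lra.
  (* The upper bound excludes [+oo]; at [-oo] the right-hand side becomes [+oo]. *)
  case: (lsupp _ _ _) => [l| |] //=.
    by rewrite -EFinB !lee_fin; lra.
  by rewrite leey.
split=> //.
have [T0|T0] := pselect (tangentpp K (g x) (jac g x *m d) !=set0).
  rewrite tangentpp_gtan in T0 *; have [lam [dl hl]] := mult 0 (lexx 0) T0.
  exists lam; split => // A TA; apply: lsupp_le => // e /hl[l' [w [ll Pw ln le]]].
  exists l', (jac g x *m w + 0 *: hess2 g x d); split => //.
    by apply: TA; exists w; rewrite ?tangentpp_gtan // scale0r addr0.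
  by apply: le_trans le _; rewrite mul0r.
(* With an empty set the support function is [-oo] by convention, so any directional multiplier will
   do. *)
have [lam [dl _]] : exists lam, dir_multipliers f g K x d lam /\ True.
  have [T2|] := tangent_dichotomy K _ _ Td; last by rewrite -tangentpp_gtan.
  by rewrite -tangent2_gtan in T2; have [lam [dl _]] := second T2; exists lam.
exists lam; split => // A _; rewrite /lsupp; case: pselect => [D0|D0] /=.
  exact: leNye.
by exfalso; apply: D0; apply/eqP; apply: contrapT => /negP/set0P.
Qed.

Theorem theorem3p8 (R : realType) (n m : nat)
  (f : 'cV[R]_n -> R) (g : 'cV[R]_n -> 'cV[R]_m) (K : set 'cV[R]_m)
  (xbar : 'cV[R]_n) (kappa delta : R) :
  C2fun f -> C2map g -> closed K ->
  solset f g K !=set0 ->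
  local_2nd_weak_sharp_min f g K xbar kappa delta ->
  MSCQ g K xbar ->
  forall eps : R, 0 <= eps < 2^-1 ->
  exists delta' : R, 0 < delta' < delta /\
  (forall x d, solset f g K x -> eball xbar delta' x ->
     crit_cone f g K x d -> prox_normal_eps (solset f g K) x eps d ->
     (* (i) *)
     (exists lam, dir_multipliers f g K x d lam /\
        (forall A, Theta g K x d `<=` A ->
           (lsupp (tangentpp K (g x) (jac g x *m d)) A lam <= 0)%E) /\
        (lsupp_full (tangentpp K (g x) (jac g x *m d)) lam <= 0)%E) /\
     (* (ii) *)
     (tangent2 K (g x) (jac g x *m d) !=set0 ->
      exists lam, dir_multipliers f g K x d lam /\
        (forall B, Omega g K x d `<=` B ->
           ((2 * kappa * (1 - 2 * eps) ^+ 2 * enorm d ^+ 2)%R%:E <=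
            (qform (hess (fun y => lagr f g y lam) x) d)%R%:E
              - lsupp (tangent2 K (g x) (jac g x *m d)) B lam)%E) /\
        ((2 * kappa * (1 - 2 * eps) ^+ 2 * enorm d ^+ 2)%R%:E <=
            (qform (hess (fun y => lagr f g y lam) x) d)%R%:E
              - lsupp_full (tangent2 K (g x) (jac g x *m d)) lam)%E)) /\
  (forall x d, solset f g K x -> eball xbar delta' x ->
     crit_cone f g K x d ->
     (* (i) *)
     (exists lam, dir_multipliers f g K x d lam /\
        (forall A, Theta g K x d `<=` A ->
           (lsupp (tangentpp K (g x) (jac g x *m d)) A lam <= 0)%E) /\
        (lsupp_full (tangentpp K (g x) (jac g x *m d)) lam <= 0)%E) /\
     (* (ii) with 2 kappa dist(d, T_S(x))^2 *)
     (tangent2 K (g x) (jac g x *m d) !=set0 ->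
      exists lam, dir_multipliers f g K x d lam /\
        (forall B, Omega g K x d `<=` B ->
           ((2 * kappa * setdist d (tangent_cone (solset f g K) x) ^+ 2)%R%:E <=
            (qform (hess (fun y => lagr f g y lam) x) d)%R%:E
              - lsupp (tangent2 K (g x) (jac g x *m d)) B lam)%E) /\
        ((2 * kappa * setdist d (tangent_cone (solset f g K) x) ^+ 2)%R%:E <=
            (qform (hess (fun y => lagr f g y lam) x) d)%R%:E
              - lsupp_full (tangent2 K (g x) (jac g x *m d)) lam)%E)).
Proof.
move=> cf cg cK _ [Fxb [k0 [d0 sharp]]] [del0 [kap [del00 [kap0 sub]]]] eps /andP[e0 e1].
(* Half the radius: a ball of radius [r0] around a point [r0]-close to [xbar] stays inside both
   given balls. *)
pose r0 := Num.min delta del0 / 2.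
have r00 : 0 < r0 by rewrite divr_gt0 // lt_min d0.
have r0d : r0 + r0 <= delta by rewrite -splitr ge_min lexx.
have r0d0 : r0 + r0 <= del0 by rewrite -splitr ge_min lexx orbT.
have near (x y : 'cV[R]_n) : enorm (x - xbar) < r0 -> enorm (y - x) < r0 ->
    enorm (y - xbar) < r0 + r0.
  by move=> h1 h2; apply: le_lt_trans (ler_enorm_dist x _ _) _; rewrite ltrD.
(* Quadratic growth passes from [xbar] to a solution [x] because [f x <= f xbar], [xbar] being
   feasible. *)
have main (x d : 'cV[R]_n) : solset f g K x -> eball xbar r0 x ->
    crit_cone f g K x d -> _ := fun Sx xr cd =>
  second_order_conditions f g K x d kappa kap r0 cf cg cK k0 kap0 r00 Sx cd
    (fun y Fy yx => le_trans (lerD (proj2 Sx _ Fxb) (lexx _))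
       (sharp y Fy (lt_le_trans (near x y xr yx) r0d)))
    (fun y yx => sub y (lt_le_trans (near x y xr yx) r0d0)).
exists r0; split; first by rewrite r00 (lt_le_trans _ r0d) // ltrDl.
split=> [x d Sx xr cd pd|x d Sx xr cd].
  have [[lam [dl hl]] h2] := main x d Sx xr cd; split.
    by exists lam; split => //; split => [A /hl//|]; exact: hl.
  move=> /h2[mu [dm hm]]; exists mu; split => //.
  have b : 2 * kappa * (1 - 2 * eps) ^+ 2 * enorm d ^+ 2 <=
      2 * kappa * setdist d (tangent_cone (solset f g K) x) ^+ 2.
    have pe : 0 <= (1 - 2 * eps) * enorm d by rewrite mulr_ge0 //; lra.
    have le := prox_normal_eps_dist _ _ _ _ pd.
    rewrite -mulrA -exprMn ler_pM2l ?mulr_gt0 // ler_sqr ?nnegrE //.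
    exact: le_trans pe le.
  by split=> [B OB|]; apply: hm => //.
have [[lam [dl hl]] h2] := main x d Sx xr cd; split.
  by exists lam; split => //; split => [A /hl//|]; exact: hl.
by move=> /h2[mu [dm hm]]; exists mu; split => //; split=> [B OB|]; apply: hm => //.
Qed.
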